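(* Let $n\ge 1$ and let $X_1,\dots,X_n$ be independent random variables with distribution function $F$ having a convex probability density $f$ on $[0,\infty)$. Let $\mathbb{F}$ be the empirical distribution function of $X_1,\dots,X_n$, let $\hat f_{ml}$ and $\hat f_{ls}$ be the nonparametric maximum likelihood estimator and the least squares estimator of a convex density on $[0,\infty)$ based on $X_1,\dots,X_n$, and let $\hat F_{ml}(r)=\int_0^r \hat f_{ml}(x)\,dx$ and $\hat F_{ls}(r)=\int_0^r \hat f_{ls}(x)\,dx$ for $r\ge 0$. Then, almost surely, $$\inf_{[0,\infty)} (\hat{F}_{ml} - F) \;\ge\; \frac{3}{2} \inf_{[0,\infty)} (\mathbb{F} - F) - \frac{1}{2} \sup_{[0,\infty)} (\mathbb{F} - F)$$ and $$\big\| \hat{F}_{ls} - F \big\|_\infty \;\le\; 2 \, \big\| \mathbb{F} - F \big\|_\infty .$$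
   Context: The empirical distribution function is $\mathbb{F}(x)=n^{-1}\#\{i: X_i\le x\}$, and $\int h\,d\mathbb{F}=n^{-1}\sum_{i=1}^n h(X_i)$. The norm is $\|H\|_\infty=\sup_{x\in[0,\infty)}|H(x)|$. Let $\mathcal{K}$ denote the convex cone of all convex and (Lebesgue-)integrable real-valued functions on $[0,\infty)$; such functions are necessarily nonnegative and non-increasing. The estimators are defined by $$\hat{f}_{ml} = \operatorname*{argmax}_{h \in \mathcal{K}} \Big( \int \log h \, d\mathbb{F} - \int_0^\infty h(x) \, dx \Big),\qquad \hat{f}_{ls} = \operatorname*{argmin}_{h \in \mathcal{K}} \Big( \int_0^\infty h(x)^2\, dx - 2 \int h \, d\mathbb{F} \Big),$$ with the convention $\log 0=-\infty$. It is known (Groeneboom, Jongbloed and Wellner) that both estimators are well-defined and unique (the value at the single point $0$ is immaterial for $\hat F_{ml}$, $\hat F_{ls}$). Since $F$ has a density on $[0,\infty)$, almost surely the observations $X_1,\dots,X_n$ are strictly positive and pairwise distinct. *)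

(* Defs.v *)
From HB Require Import structures.
From mathcomp Require Import all_boot all_order all_algebra.
From mathcomp Require Import all_classical all_reals all_analysis.

Set Implicit Arguments.
Unset Strict Implicit.
Unset Printing Implicit Defensive.

Import Order.TTheory GRing.Theory Num.Theory.
Import numFieldNormedType.Exports.

Local Open Scope classical_set_scope.
Local Open Scope ring_scope.

Definition mutually_independent (d : measure_display) (T : measurableType d)
    (R : realType) (P : probability T R) (n : nat)
    (X : 'I_n -> {RV P >-> R}) : Prop :=
  forall (J : {set 'I_n}) (A : 'I_n -> set R),
    (forall i, i \in J -> measurable (A i)) ->
    P (\bigcap_(i in [set` J]) (X i @^-1` A i)) =
      (\prod_(i in J) P (X i @^-1` A i))%E.

(* Functions on the half-line are represented by maps R -> R; only their
   restriction to [0, +oo[ matters. *)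
Definition convex_cone (R : realType) : set (R -> R) :=
  [set h | convex_function (`[0, +oo[ : set R) h /\
    (@lebesgue_measure R).-integrable `[0, +oo[ (EFin \o h)].

Definition convex_density (R : realType) (f : R -> R) : Prop :=
  [/\ convex_cone f,
      forall x, 0 <= x -> 0 <= f x &
      (\int[@lebesgue_measure R]_(x in `[0%R, +oo[) (f x)%:E = 1)%E].

Definition primitive (R : realType) (f : R -> R) (r : R) : R :=
  \int[@lebesgue_measure R]_(x in `[0, r]) f x.

Section Estimators.
Context {R : realType} {n : nat}.
Implicit Types (x : 'I_n -> R) (h : R -> R).

Definition edf x (r : R) : R := n%:R^-1 * #|[set i | x i <= r]%SET|%:R.

(* Extended-real-valued integrands, so that log 0 = -oo is allowed. *)
Definition edf_integral x (g : R -> \bar R) : \bar R :=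
  ((n%:R^-1)%:E * \sum_(i < n) g (x i))%E.

(* lne r%:E = -oo for r <= 0. *)
Definition ml_criterion x h : \bar R :=
  (edf_integral x (fun t => lne (h t)%:E)
   - \int[@lebesgue_measure R]_(t in `[0%R, +oo[) (h t)%:E)%E.

Definition ls_criterion x h : \bar R :=
  (\int[@lebesgue_measure R]_(t in `[0%R, +oo[) ((h t) ^+ 2)%:E
   - 2%:E * edf_integral x (fun t => (h t)%:E))%E.

Definition is_ml_estimator x h : Prop :=
  convex_cone h /\
  forall g, convex_cone g -> (ml_criterion x g <= ml_criterion x h)%E.

Definition is_ls_estimator x h : Prop :=
  convex_cone h /\
  forall g, convex_cone g -> (ls_criterion x h <= ls_criterion x g)%E.

End Estimators.

(* Real-valued inf and sup: they are the genuine ones for bounded H, e.g. for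
   differences of an integrated element of convex_cone, an empirical
   distribution function and a distribution function. *)
Definition inf_halfline (R : realType) (H : R -> R) : R :=
  inf [set H x | x in `[0, +oo[].

Definition sup_halfline (R : realType) (H : R -> R) : R :=
  sup [set H x | x in `[0, +oo[].

Definition sup_norm (R : realType) (H : R -> R) : R :=
  sup_halfline (fun x => `|H x|).

(* Main.v *)
(* An estimator [h] optimizes a concave or convex criterion over a convex cone,
   hence [Lam g >= Lam h] for all [g] in the cone, where [Lam] is the difference
   of two positive functionals: Lebesgue measure with a weight, minus a discrete
   measure on the sample (weights [h] and [1/n] for least squares, [1] and
   [1/(n h(x_i))] for maximum likelihood). Testing with the hinges [(s - x)^+]
   gives a nonnegative function [gap s], and testing with the part of [h] above
   its tangent at [s] (which can be added to or subtracted from [h] inside the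
   cone) shows that [h] is affine on every interval where [gap] does not vanish,
   while at the zeros of [gap] the fitted and empirical distribution functions
   agree. This makes the knots of [h], and their finiteness, irrelevant.

   On such an interval ]a, b[ the difference [h - f] is concave. Where it is
   nonnegative, comparing it with a line through two of its values bounds the
   average over [a, p] (resp. [p, b]) of the difference D of the distribution
   functions by 2/3 D(p) + 1/3 D(a) from above (resp. 2/3 D(p) + 1/3 D(b) from
   below), whereas [gap] compares these averages with those of the empirical
   process; elsewhere D decreases. *)
Require Import Defs.
From HB Require Import structures.
From mathcomp Require Import all_boot all_order all_algebra.
From mathcomp Require Import all_classical all_reals all_analysis.
From mathcomp Require Import measurable_realfun.
From mathcomp Require Import ring lra.

Set Implicit Arguments.
Unset Strict Implicit.
Unset Printing Implicit Defensive.

Import Order.TTheory GRing.Theory Num.Theory.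
Import numFieldNormedType.Exports.

Local Open Scope classical_set_scope.
Local Open Scope ring_scope.

(** * Convexity on the half-line: support lines and right slopes *)

Section Convexity.
Context {R : realType}.
Implicit Types (h g : R -> R) (x y z s t : R).

Lemma convex_halflineP h : convex_function (`[0, +oo[ : set R) h <->
  forall x y t, 0 <= x -> 0 <= y -> 0 <= t <= 1 ->
    h (t * x + (1 - t) * y) <= t * h x + (1 - t) * h y.
Proof.
split.
  move=> ch x y t x0 y0 t01.
  have := ch (Itv01 (proj1 (andP t01)) (proj2 (andP t01))) x y.
  rewrite !inE/= !in_itv/= x0 y0 => /(_ isT isT).
  by rewrite !convRE.
move=> ch t x y; rewrite !inE/= !in_itv/= !andbT => x0 y0.
rewrite !convRE; apply: ch => //; by apply/andP; split.
Qed.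

Lemma convex_three_points h x y z : convex_function (`[0, +oo[ : set R) h ->
  0 <= x -> x < y -> y < z -> (z - x) * h y <= (z - y) * h x + (y - x) * h z.
Proof.
move=> /convex_halflineP ch x0 xy yz.
have zx : 0 < z - x by lra.
have z0 : 0 <= z by lra.
have t01 : 0 <= (z - y) / (z - x) <= 1.
  by rewrite divr_ge0 ?ler_pdivrMr//=; lra.
have := ch x z ((z - y) / (z - x)) x0 z0 t01.
have -> : (z - y) / (z - x) * x + (1 - (z - y) / (z - x)) * z = y by field; lra.
have -> : (z - y) / (z - x) * h x + (1 - (z - y) / (z - x)) * h z =
  ((z - y) * h x + (y - x) * h z) / (z - x) by field; lra.
by rewrite ler_pdivlMr// [h y * _]mulrC.
Qed.

(** Averaging the support line at [t * x + (1 - t) * y] over its values at [x] and [y] gives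
    convexity. Support lines at interior points suffice: a proper convex combination of nonnegative
    points is 0 only when both points are 0. *)
Lemma convex_of_support_lines h :
  (forall x, 0 < x -> exists k, forall y, 0 <= y -> h x + k * (y - x) <= h y) ->
  convex_function (`[0, +oo[ : set R) h.
Proof.
move=> sh; apply/convex_halflineP => x y t x0 y0 /andP[t0 t1].
have [->|tN0] := eqVneq t 0; first by rewrite !mul0r !add0r subr0 !mul1r.
have [->|tN1] := eqVneq t 1; first by rewrite subrr !mul0r !addr0 !mul1r.
have {tN0}t0 : 0 < t by rewrite lt_neqAle eq_sym tN0.
have {tN1}t1 : 0 < 1 - t by rewrite subr_gt0 lt_neqAle tN1.
have [z0|] := ltP 0 (t * x + (1 - t) * y).
  have [k hk] := sh _ z0.
  have hx := hk _ x0; have hy := hk _ y0.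
  set c := h (t * x + (1 - t) * y) in hx hy *.
  have := lerD (ler_wpM2l (ltW t0) hx) (ler_wpM2l (ltW t1) hy).
  by apply: le_trans; rewrite le_eqVlt; apply/orP; left; apply/eqP; ring.
move=> z0.
have tx : 0 <= t * x by exact: mulr_ge0 (ltW t0) x0.
have ty : 0 <= (1 - t) * y by exact: mulr_ge0 (ltW t1) y0.
have /eqP : t * x = 0 by lra.
have /eqP : (1 - t) * y = 0 by lra.
rewrite !mulf_eq0 (gt_eqF t0) (gt_eqF t1)/= => /eqP -> /eqP ->.
by rewrite !mulr0 addr0; lra.
Qed.

(** For convex [h] and [x > 0] this is the right derivative, since difference quotients decrease as
    [y] approaches [x]; the infimum form avoids a limit. *)
Definition rslope h x : R :=
  inf [set (h y - h x) / (y - x) | y in [set y | x < y]].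

Section Slope.
Variable h : R -> R.
Hypothesis ch : convex_function (`[0, +oo[ : set R) h.

Lemma rslope_has_inf x : 0 < x ->
  has_inf [set (h y - h x) / (y - x) | y in [set y | x < y]].
Proof.
move=> x0; split; first by exists ((h (x + 1) - h x) / (x + 1 - x)), (x + 1) => //=; lra.
(* The slope of the chord from 0 to [x] is below all slopes to the right of [x]; here [0 < x]
   matters. *)
exists ((h x - h 0) / x) => _ [y /= xy <-].
have := convex_three_points ch (lexx 0) x0 xy; rewrite !subr0 => H.
rewrite ler_pdivrMr// mulrAC ler_pdivlMr//; nra.
Qed.

Lemma rslope_support x y : 0 < x -> 0 <= y ->
  h x + rslope h x * (y - x) <= h y.
Proof.
move=> x0 y0; have [xy|yx|->] := ltgtP x y; last by rewrite subrr mulr0 addr0.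
- have yx0 : 0 < y - x by lra.
  suff : rslope h x <= (h y - h x) / (y - x) by rewrite ler_pdivlMr//; lra.
  by apply: ge_inf; [exact: (rslope_has_inf x0).2|exists y].
- have yx0 : 0 < x - y by lra.
  suff : (h x - h y) / (x - y) <= rslope h x by rewrite ler_pdivrMr//; nra.
  apply: lb_le_inf; first exact: (rslope_has_inf x0).1.
  move=> _ [z /= xz <-].
  have zx0 : 0 < z - x by lra.
  have H := convex_three_points ch y0 yx xz.
  rewrite ler_pdivrMr// mulrAC ler_pdivlMr//; nra.
Qed.

Lemma rslope_nondecreasing x y : 0 < x -> x <= y -> rslope h x <= rslope h y.
Proof.
move=> x0; rewrite le_eqVlt => /predU1P[->//|xy].
have y0 : 0 < y by lra.
have := rslope_support x0 (ltW y0); have := rslope_support y0 (ltW x0).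
have yx : 0 < y - x by lra.
move=> Hx Hy; rewrite -(ler_pM2r yx); lra.
Qed.

End Slope.

End Convexity.

(** * Integrals over the half-line, the test functions [below] and [hinge], and basic properties of
    the cone *)

Section Integration.
Context {R : realType}.
Notation mu := (@lebesgue_measure R).
Notation H := (`[0%R, +oo[%classic : set R).
Implicit Types (f g h w : R -> R) (a b c s t x : R).

Definition summable_fun g := mu.-integrable H (EFin \o g).

Definition half_int g : R := \int[mu]_(x in H) g x.

Definition below s x : R := (x <= s)%R%:R.

Definition hinge s x : R := Num.max (s - x) 0.

Lemma halflineP x : H x <-> 0 <= x.
Proof. by rewrite /= in_itv/= andbT. Qed.

Lemma measurable_halfline : measurable H.
Proof. exact: measurable_itv. Qed.
Hint Resolve measurable_halfline : core.

Lemma below1 s x : x <= s -> below s x = 1.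
Proof. by rewrite /below => ->. Qed.

Lemma below0 s x : s < x -> below s x = 0.
Proof. by rewrite /below ltNge => /negbTE ->. Qed.

Lemma hinge_left s x : x <= s -> hinge s x = s - x.
Proof. by move=> xs; rewrite /hinge max_l// subr_ge0. Qed.

Lemma hinge_right s x : s <= x -> hinge s x = 0.
Proof. by move=> sx; rewrite /hinge max_r// subr_le0. Qed.

Lemma below_ge0 s x : 0 <= below s x.
Proof. by rewrite /below ler0n. Qed.

Lemma below_le1 s x : below s x <= 1.
Proof. by rewrite /below lern1 leq_b1. Qed.

Lemma hinge_ge0 s x : 0 <= hinge s x.
Proof. by rewrite /hinge le_max lexx orbT. Qed.

Lemma measurable_below s : measurable_fun H (below s).
Proof.
apply: nonincreasing_measurable => // x y xy.
by rewrite /below ler_nat; case: (leP y s) => // ys; rewrite (le_trans xy).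
Qed.

Lemma measurable_hinge s : measurable_fun H (hinge s).
Proof.
apply: nonincreasing_measurable => // x y xy.
by rewrite /hinge ge_max !le_max !lexx !orbT andbT lerD2l lerN2 xy.
Qed.

Lemma summable_measurable g : summable_fun g -> measurable_fun H g.
Proof. by move=> /(@measurable_int _ _ _ mu) /measurable_EFinP. Qed.

Lemma summable_dominated f g : measurable_fun H f ->
  (forall x, 0 <= x -> `|f x| <= `|g x|) -> summable_fun g -> summable_fun f.
Proof.
move=> mf fg; apply: le_integrable => //; first exact/measurable_EFinP.
by move=> x /halflineP x0 /=; rewrite lee_fin fg.
Qed.

Lemma summable_eq f g : (forall x, 0 <= x -> f x = g x) ->
  summable_fun f -> summable_fun g.
Proof.
move=> fg; apply: eq_integrable => // x; rewrite inE => /halflineP x0 /=.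
by rewrite fg.
Qed.

Lemma summable_funD f g : summable_fun f -> summable_fun g ->
  summable_fun (fun x => f x + g x).
Proof. by move=> sf sg; exact: (integrableD _ sf sg). Qed.

Lemma summable_funB f g : summable_fun f -> summable_fun g ->
  summable_fun (fun x => f x - g x).
Proof. by move=> sf sg; exact: (integrableB _ sf sg). Qed.

Lemma summable_funZ c g : summable_fun g -> summable_fun (fun x => c * g x).
Proof. by move=> sg; exact: (integrableZl _ c sg). Qed.

Lemma summable_funM w g c : measurable_fun H w -> (forall x, 0 <= x -> `|w x| <= c) ->
  summable_fun g -> summable_fun (fun x => w x * g x).
Proof.
move=> mw wc sg; apply: (@summable_dominated _ (fun x => c * g x)).
- by apply: measurable_funM => //; exact: summable_measurable.
- move=> x x0; rewrite !normrM ler_wpM2r// (le_trans (wc _ x0))// ler_norm//.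
- exact: summable_funZ.
Qed.

Lemma summable_below s : summable_fun (below s).
Proof.
have : summable_fun (\1_(`[0, s]%classic : set R)).
  by apply: integrableS (integrable_indic_itv 0 s true false).
apply: summable_eq => x x0; rewrite indicE /below; congr (_%:R).
by rewrite mem_setE in_itv/= x0.
Qed.

Lemma summable_hinge s : summable_fun (hinge s).
Proof.
apply: (@summable_dominated _ (fun x => s * below s x)).
- exact: measurable_hinge.
- move=> x x0; rewrite ger0_norm ?hinge_ge0// /hinge /below.
  have [xs|sx] := leP x s.
  + by rewrite mulr1 ge_max normr_ge0 andbT (le_trans _ (ler_norm _))//; lra.
  + by rewrite ge_max normr_ge0 andbT mulr0 normr0; lra.
- exact/summable_funZ/summable_below.
Qed.

Lemma summable_below_mul s g : summable_fun g ->
  summable_fun (fun x => below s x * g x).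
Proof.
apply: (@summable_funM _ _ 1); first exact: measurable_below.
by move=> x x0; rewrite ger0_norm ?below_ge0 ?below_le1.
Qed.

Lemma half_int_below s : 0 <= s -> half_int (below s) = s.
Proof.
move=> s0; transitivity (\int[mu]_(x in H `&` `]-oo, s]%classic) cst 1 x).
  rewrite Rintegral_mkcondr; apply: eq_Rintegral => x.
  rewrite inE => /halflineP x0; rewrite patchE mem_setE in_itv/= /below.
  by case: ifP.
have -> : H `&` `]-oo, s]%classic = `[0, s]%classic :> set R.
  by apply/seteqP; split => x /=; rewrite !in_itv/= ?andbT => /andP.
rewrite Rintegral_cst// mul1r.
have := lebesgue_measure_itv `[0, s].
rewrite /= lte_fin => ->.
by move: s0; rewrite le_eqVlt => /predU1P[<-|->]; rewrite ?ltxx //= subr0.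
Qed.

Lemma half_intD f g : summable_fun f -> summable_fun g ->
  half_int (fun x => f x + g x) = half_int f + half_int g.
Proof. by move=> sf sg; rewrite /half_int RintegralD. Qed.

Lemma half_intB f g : summable_fun f -> summable_fun g ->
  half_int (fun x => f x - g x) = half_int f - half_int g.
Proof. by move=> sf sg; rewrite /half_int RintegralB. Qed.

Lemma half_intZ c g : summable_fun g ->
  half_int (fun x => c * g x) = c * half_int g.
Proof. by move=> sg; rewrite /half_int RintegralZl. Qed.

Lemma le_half_int f g : summable_fun f -> summable_fun g ->
  (forall x, 0 <= x -> f x <= g x) -> half_int f <= half_int g.
Proof.
by move=> sf sg fg; apply: le_Rintegral => // x /halflineP x0; exact: fg.
Qed.

Lemma eq_half_int f g : (forall x, 0 <= x -> f x = g x) ->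
  half_int f = half_int g.
Proof.
by move=> fg; apply: eq_Rintegral => x; rewrite inE => /halflineP; exact: fg.
Qed.

Lemma primitiveE f s : primitive f s = half_int (fun x => below s x * f x).
Proof.
rewrite /primitive.
have -> : `[0, s]%classic = H `&` `]-oo, s]%classic :> set R.
  by apply/seteqP; split => x /=; rewrite !in_itv/= ?andbT => /andP.
rewrite Rintegral_mkcondr; apply: eq_Rintegral => x _.
rewrite patchE mem_setE in_itv/= /below.
by case: ifP; rewrite ?mul1r ?mul0r.
Qed.

Lemma no_positive_tail g a c : summable_fun g -> 0 < c ->
  ~ (forall x, a <= x -> c <= g x).
Proof.
move=> sg c0 ag.
have sn : summable_fun (fun x => `|g x|).
  apply: (summable_dominated _ _ sg); last by move=> x _; rewrite normr_id.
  exact: (measurableT_comp (@normr_measurable R setT) (summable_measurable sg)).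
set N := half_int (fun x => `|g x|).
set a' := Num.max a 0.
have a'0 : 0 <= a' by rewrite /a' le_max lexx orbT.
have N0 : 0 <= N by apply: Rintegral_ge0.
(* Over an interval of length [(N + 1) / c] the constant [c] already has integral [N + 1], more than
   the integral [N] of the absolute value of [g]. *)
set t := a' + (N + 1) / c.
have t0 : a' <= t by rewrite /t lerDl divr_ge0//; lra.
have : half_int (fun x => c * (below t x - below a' x)) <= N.
  apply: le_half_int => //.
    by apply: summable_funZ; apply: summable_funB; exact: summable_below.
  move=> x x0; rewrite /below; have [xa|ax] := leP x a'.
    by rewrite (le_trans xa t0) subrr mulr0.
  rewrite subr0; have [xt|tx] := leP x t; last by rewrite mulr0.
  have ax' : a <= x by apply: le_trans (ltW ax); rewrite /a' le_max lexx.
  by rewrite mulr1; exact: le_trans (ag _ ax') (ler_norm _).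
rewrite half_intZ; last by apply: summable_funB; exact: summable_below.
rewrite half_intB; [|exact: summable_below..].
rewrite !half_int_below//; last exact: le_trans t0.
rewrite /t [_ + _ - _]addrAC subrr add0r mulrC divfK ?gt_eqF//; lra.
Qed.

Section ConvexCone.
Variable h : R -> R.
Hypothesis Kh : convex_cone h.

Lemma cone_nonincreasing x y : 0 <= x -> x <= y -> h y <= h x.
Proof.
case: Kh => ch sh x0; rewrite le_eqVlt => /predU1P[->//|xy].
rewrite leNgt; apply/negP => hxy.
have yx : 0 < y - x by lra.
have hh : 0 < h y - h x by lra.
(* If [h x < h y], then beyond [y] convexity keeps [h] above the extended chord, which is at least 1
   from this point on. *)
apply: (@no_positive_tail h (y + (`|h y| + 1) * (y - x) / (h y - h x)) 1) => //.
move=> z zx.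
have q0 : 0 < (`|h y| + 1) * (y - x) / (h y - h x).
  by rewrite divr_gt0// mulr_gt0// ltr_pwDr.
have yz : y < z by lra.
have H3 := convex_three_points ch x0 xy yz.
have : (`|h y| + 1) * (y - x) / (h y - h x) <= z - y by lra.
rewrite ler_pdivrMr// => H4.
have := ler_norm (- h y); rewrite normrN => H5.
rewrite -(ler_pM2l yx); nra.
Qed.

(** A negative value would persist to the right by monotonicity and contradict integrability. *)
Lemma cone_ge0 x : 0 <= x -> 0 <= h x.
Proof.
case: Kh => ch sh x0; rewrite leNgt; apply/negP => hx0.
apply: (@no_positive_tail (fun y => - 1 * h y) x (- h x)).
- exact: summable_funZ.
- by rewrite oppr_gt0.
- by move=> y xy; rewrite mulN1r lerN2 cone_nonincreasing.
Qed.

Lemma cone_le0 x : 0 <= x -> h x <= h 0.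
Proof. by move=> x0; apply: cone_nonincreasing. Qed.

Lemma cone_norm_le x : 0 <= x -> `|h x| <= h 0.
Proof. by move=> x0; rewrite ger0_norm ?cone_ge0 ?cone_le0. Qed.

Lemma cone_summable : summable_fun h.
Proof. by case: Kh. Qed.

Lemma cone_measurable : measurable_fun H h.
Proof. exact: summable_measurable cone_summable. Qed.

End ConvexCone.

Lemma coneD g h : convex_cone g -> convex_cone h ->
  convex_cone (fun x => g x + h x).
Proof.
move=> [/convex_halflineP cg sg] [/convex_halflineP ch sh]; split.
  apply/convex_halflineP => x y t x0 y0 t01 /=.
  by have := cg _ _ _ x0 y0 t01; have := ch _ _ _ x0 y0 t01; lra.
exact: summable_funD.
Qed.

Lemma coneZ c g : 0 <= c -> convex_cone g -> convex_cone (fun x => c * g x).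
Proof.
move=> c0 [/convex_halflineP cg sg]; split; last exact: summable_funZ.
apply/convex_halflineP => x y t x0 y0 t01 /=.
by have := ler_wpM2l c0 (cg _ _ _ x0 y0 t01); lra.
Qed.

Lemma cone_hinge s : convex_cone (hinge s).
Proof.
split; last exact: summable_hinge.
apply: convex_of_support_lines => x _; have [xs|sx] := leP x s.
  exists (- 1) => y _; rewrite /hinge.
  by rewrite (@max_l _ _ (s - x)) ?subr_ge0// le_max; apply/orP; left; lra.
exists 0 => y _; rewrite mul0r addr0 /hinge.
by rewrite (@max_r _ _ (s - x)) ?subr_le0 ?(ltW sx)// le_max lexx orbT.
Qed.

End Integration.
#[global] Hint Resolve measurable_halfline : core.

(** * Limit, connectedness and extremal-zero arguments on the real line *)

Section RealLine.
Context {R : realType}.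
Implicit Types (r phi Y : R -> R) (a b p q s t u v L : R).

(** Stands in for letting [e] tend to 0 in first-order conditions, one-sided derivatives and
    passages to an endpoint. *)
Lemma le_epsilon_linear u v L d : 0 < d -> 0 <= L ->
  (forall e, 0 < e -> e <= d -> u <= v + L * e) -> u <= v.
Proof.
move=> d0 L0 uv; rewrite leNgt; apply/negP => vu.
set e := Num.min d ((u - v) / (2 * (L + 1))).
have L1 : 0 < 2 * (L + 1) by lra.
have q0 : 0 < (u - v) / (2 * (L + 1)) by rewrite divr_gt0// subr_gt0.
have e0 : 0 < e by rewrite lt_min d0.
have ed : e <= d by rewrite ge_min lexx.
have : e <= (u - v) / (2 * (L + 1)) by rewrite ge_min lexx orbT.
rewrite ler_pdivlMr// => He.
have := uv e e0 ed; nra.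
Qed.

(** Connectedness of [[u, v]]: the supremum of the points where [r] takes the value [r u] is itself
    such a point, and local constancy would push it further if it were less than [v]. *)
Lemma locally_constant r u v : u <= v ->
  (forall s, u <= s -> s <= v -> exists2 e, 0 < e &
     forall t, u <= t -> t <= v -> `|t - s| < e -> r t = r s) ->
  r v = r u.
Proof.
move=> uv lc.
pose S := [set s | u <= s <= v /\ r s = r u].
have Su : S u by split; rewrite ?lexx.
have hS : has_sup S by split; [exists u|exists v => s [/andP[]]].
have us : u <= sup S by apply: ub_le_sup hS.2 _ Su.
have sv : sup S <= v by apply: ge_sup; [exists u|move=> s [/andP[]]].
have [e e0 He] := lc _ us sv.
have [t [/andP[ut tv] rt] tS] := sup_adherent e0 hS.
have ts : t <= sup S by apply: (ub_le_sup hS.2); split=> //; apply/andP.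
have rs : r (sup S) = r u.
  by rewrite -rt (He t)// ltr_norml; lra.
have [svlt|] := ltP (sup S) v; last first.
  by move=> vs; rewrite -rs; congr r; apply/eqP; rewrite eq_le sv vs.
set w := Num.min v (sup S + e / 2).
have wv : w <= v by rewrite ge_min lexx.
have we : w <= sup S + e / 2 by rewrite ge_min lexx orbT.
have sw : sup S < w by rewrite lt_min svlt/=; lra.
have Sw : S w.
  split; first by lra.
  by rewrite (He w) ?rs ?ltr_norml//; lra.
by have := ub_le_sup hS.2 Sw; lra.
Qed.

(** Over [n.+1] equal pieces of [[u, v]] the defects add up to [L * (v - u) ^+ 2 / n.+1%:R], which
    vanishes in the limit. This replaces the integration of a derivative. *)
Lemma nondecreasing_of_quadratic_defect Y u v L : u <= v -> 0 <= L ->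
  (forall s t, u <= s -> s <= t -> t <= v ->
     Y s <= Y t + L * (t - s) ^+ 2) ->
  Y u <= Y v.
Proof.
move=> uv L0 HY.
have step n : Y u <= Y v + L * (v - u) ^+ 2 / n.+1%:R.
  set d := (v - u) / n.+1%:R.
  have n0 : 0 < n.+1%:R :> R by rewrite ltr0n.
  have d0 : 0 <= d by rewrite divr_ge0// subr_ge0.
  have dn : d * n.+1%:R = v - u by rewrite divfK// gt_eqF.
  have H k : (k <= n.+1)%N -> Y u <= Y (u + k%:R * d) + k%:R * (L * d ^+ 2).
    elim: k => [|k IH] kn; first by rewrite !mul0r !addr0.
    apply: (le_trans (IH (ltnW kn))).
    have kd : k.+1%:R * d <= v - u.
      by rewrite -dn mulrC ler_wpM2l// ler_nat.
    have kd0 : 0 <= k%:R * d by rewrite mulr_ge0.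
    have k1 : k.+1%:R * d = k%:R * d + d by rewrite -natr1 mulrDl mul1r.
    have := HY (u + k%:R * d) (u + k.+1%:R * d).
    have -> : u + k.+1%:R * d - (u + k%:R * d) = d by rewrite k1; ring.
    have -> : k.+1%:R * (L * d ^+ 2) = k%:R * (L * d ^+ 2) + L * d ^+ 2.
      by rewrite -natr1 mulrDl mul1r.
    move=> HH; have := HH ltac:(lra) ltac:(lra) ltac:(lra); lra.
  have := H n.+1 (leqnn _); rewrite mulrC dn.
  have -> : u + (v - u) = v by ring.
  suff -> : n.+1%:R * (L * d ^+ 2) = L * (v - u) ^+ 2 / n.+1%:R by [].
  by rewrite /d; field; rewrite gt_eqF.
apply/ler_addgt0Pr => e e0.
have c0 : 0 <= L * (v - u) ^+ 2 by rewrite mulr_ge0// sqr_ge0.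
have := archi_boundP (divr_ge0 c0 (ltW e0)).
set n := Num.bound _ => Hn.
apply: (le_trans (step n)); rewrite lerD2l.
rewrite ler_pdivrMr ?ltr0n//.
move: Hn; rewrite ltr_pdivrMr// => Hn; rewrite -natr1; nra.
Qed.

(** The supremum of the zeros in [[0, p]] is again a zero, by the continuity contained in the
    Lipschitz bound. *)
Lemma last_zero phi p L : 0 < p -> 0 <= L ->
  (forall s t, 0 <= s -> s <= t -> t <= p -> `|phi t - phi s| <= L * (t - s)) ->
  phi 0 = 0 -> phi p <> 0 ->
  exists a, [/\ 0 <= a, a < p, phi a = 0 &
    forall s, a < s -> s <= p -> phi s <> 0].
Proof.
move=> p0 L0 Lip z0 zp.
pose S := [set s | 0 <= s <= p /\ phi s = 0].
have S0 : S 0 by split; rewrite ?lexx ?ltW.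
have hS : has_sup S by split; [exists 0|exists p => s [/andP[]]].
have us : 0 <= sup S by apply: ub_le_sup hS.2 _ S0.
have sv : sup S <= p by apply: ge_sup; [exists 0|move=> s [/andP[]]].
have zs : phi (sup S) = 0.
  apply/eqP; rewrite -normr_le0; apply: (@le_epsilon_linear _ _ L 1) => // e e0 _.
  have [t [/andP[t0 tp] zt] tS] := sup_adherent e0 hS.
  have ts : t <= sup S by apply: (ub_le_sup hS.2); split=> //; apply/andP.
  have := Lip t (sup S) t0 ts sv; rewrite zt subr0 add0r => /le_trans; apply.
  by rewrite ler_wpM2l//; lra.
exists (sup S); split=> //.
  by rewrite lt_neqAle sv andbT; apply/eqP => e; apply: zp; rewrite -e.
move=> s ss sp zs'.
suff : s <= sup S by lra.
by apply: (ub_le_sup hS.2); split => //; lra.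
Qed.

(** Mirror image of [last_zero] under the reflection of [s] to [q - s]. *)
Lemma first_zero phi p q L : 0 <= p -> p < q -> 0 <= L ->
  (forall s t, 0 <= s -> s <= t -> t <= q -> `|phi t - phi s| <= L * (t - s)) ->
  phi q = 0 -> phi p <> 0 ->
  exists b, [/\ p < b, phi b = 0 & forall s, p <= s -> s < b -> phi s <> 0].
Proof.
move=> p0 pq L0 Lip zq zp.
have [|s t s0 st tq|||a [a0 ap za Ha]] :=
    @last_zero (fun s => phi (q - s)) (q - p) L _ L0.
- by rewrite subr_gt0.
- rewrite distrC (_ : t - s = (q - s) - (q - t)); last by ring.
  by apply: Lip; lra.
- by rewrite subr0.
- by rewrite (_ : q - (q - p) = p)//; ring.
exists (q - a); split => //; first by lra.
move=> s ps sa; rewrite (_ : s = q - (q - s)); last by ring.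
by apply: Ha; lra.
Qed.

End RealLine.

(** * Positive linear functionals: weighted Lebesgue measure and discrete measures on the sample *)

Section PositiveFunctional.
Context {R : realType}.
Notation mu := (@lebesgue_measure R).
Notation H := (`[0%R, +oo[%classic : set R).
Implicit Types (A B : (R -> R) -> R) (f g h w : R -> R) (s t u v x y : R).

(** Monotonicity refers to pointwise rather than almost everywhere inequalities, so that point
    masses qualify. *)
Definition positive_functional A : Prop :=
  [/\ forall f g, summable_fun f -> summable_fun g ->
        A (fun x => f x + g x) = A f + A g,
      forall c f, summable_fun f -> A (fun x => c * f x) = c * A f &
      forall f g, summable_fun f -> summable_fun g ->
        (forall x, 0 <= x -> f x <= g x) -> A f <= A g].

Definition weighted w g : R := half_int (fun x => w x * g x).

Definition sampled n (c x : 'I_n -> R) g : R := \sum_(i < n) c i * g (x i).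

Lemma weighted_positive w M : measurable_fun H w ->
  (forall x, 0 <= x -> 0 <= w x <= M) -> positive_functional (weighted w).
Proof.
move=> mw wM.
have sw f : summable_fun f -> summable_fun (fun x => w x * f x).
  move=> sf; apply: (summable_funM mw _ sf) => x x0.
  by have /andP[w0] := wM x x0; rewrite ger0_norm//; exact.
split=> [f g sf sg|c f sf|f g sf sg fg]; rewrite /weighted.
- rewrite -half_intD; [|exact: sw..].
  by apply: eq_half_int => x _; rewrite mulrDr.
- rewrite -half_intZ; last exact: sw.
  by apply: eq_half_int => x _; rewrite mulrCA.
- apply: le_half_int; [exact: sw..|] => x x0.
  by rewrite ler_wpM2l ?fg//; have /andP[] := wM x x0.
Qed.

Lemma sampled_positive n (c x : 'I_n -> R) : (forall i, 0 <= c i) ->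
  (forall i, 0 <= x i) -> positive_functional (sampled c x).
Proof.
move=> c0 x0; split=> [f g _ _|k f _|f g _ _ fg]; rewrite /sampled.
- by rewrite -big_split/=; apply: eq_bigr => i _; rewrite mulrDr.
- by rewrite mulr_sumr; apply: eq_bigr => i _; rewrite mulrCA.
- by apply: ler_sum => i _; rewrite ler_wpM2l ?fg.
Qed.

Section Theory.
Variable A : (R -> R) -> R.
Hypothesis pA : positive_functional A.

Lemma functionalD f g : summable_fun f -> summable_fun g ->
  A (fun x => f x + g x) = A f + A g.
Proof. by case: pA => + _ _; exact. Qed.

Lemma functionalZ c f : summable_fun f -> A (fun x => c * f x) = c * A f.
Proof. by case: pA => _ + _; exact. Qed.

Lemma le_functional f g : summable_fun f -> summable_fun g ->
  (forall x, 0 <= x -> f x <= g x) -> A f <= A g.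
Proof. by case: pA => _ _; exact. Qed.

Lemma eq_functional f g : summable_fun f ->
  (forall x, 0 <= x -> f x = g x) -> A f = A g.
Proof.
move=> sf fg; have sg := summable_eq fg sf.
by apply/eqP; rewrite eq_le !le_functional// => x x0; rewrite fg.
Qed.

Lemma functionalB f g : summable_fun f -> summable_fun g ->
  A (fun x => f x - g x) = A f - A g.
Proof.
move=> sf sg.
rewrite (@eq_functional _ (fun x => f x + (- 1) * g x)).
- by rewrite functionalD ?functionalZ ?mulN1r//; exact: summable_funZ.
- exact: summable_funB.
- by move=> x _; rewrite mulN1r.
Qed.

Lemma functional_ge0 f : summable_fun f -> (forall x, 0 <= x -> 0 <= f x) ->
  0 <= A f.
Proof.
move=> sf f0; rewrite -[X in X <= _](mul0r (A f)) -functionalZ//.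
by apply: le_functional => //; [exact: summable_funZ|move=> x x0; rewrite mul0r f0].
Qed.

Lemma hinge0 x : 0 <= x -> hinge 0 x = 0.
Proof. by move=> x0; rewrite /hinge max_r// sub0r oppr_le0. Qed.

Lemma functional_hinge0 : A (hinge 0) = 0.
Proof.
rewrite (@eq_functional _ (fun x => 0 * hinge 0 x)).
- by rewrite functionalZ ?mul0r//; exact: summable_hinge.
- exact: summable_hinge.
- by move=> x x0; rewrite mul0r hinge0.
Qed.

Lemma functional_below_le s t : s <= t -> A (below s) <= A (below t).
Proof.
move=> st; apply: le_functional; [exact: summable_below..|] => x _.
by rewrite /below ler_nat; case: (leP x s) => // xs; rewrite (le_trans xs st).
Qed.

(** Pointwise, [hinge t - hinge s] lies between [(t - s) * below s] and [(t - s) * below t]. With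
    the companion upper bound, the distribution function [A (below s)] thus plays the role of the
    derivative of [A (hinge s)]. *)
Lemma functional_hinge_ge s t : s <= t ->
  (t - s) * A (below s) <= A (hinge t) - A (hinge s).
Proof.
move=> st; rewrite -functionalZ -?functionalB; try exact: summable_below;
  try exact: summable_hinge.
apply: le_functional; first exact/summable_funZ/summable_below.
  by apply: (summable_funB); exact: summable_hinge.
move=> x x0; rewrite /below /hinge; case: (leP x s) => xs.
  by rewrite (@max_l _ _ (t - x)) ?(@max_l _ _ (s - x)) ?mulr1; lra.
rewrite mulr0 (@max_r _ _ (s - x)) ?subr0 ?le_max ?lexx ?orbT//; lra.
Qed.

Lemma functional_hinge_le s t : s <= t ->
  A (hinge t) - A (hinge s) <= (t - s) * A (below t).
Proof.
move=> st; rewrite -functionalZ -?functionalB; try exact: summable_below;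
  try exact: summable_hinge.
apply: le_functional; last first.
- move=> x x0; rewrite /below /hinge; case: (leP x t) => xt; last first.
    by rewrite (@max_r _ _ (t - x)) ?(@max_r _ _ (s - x)) ?mulr0; lra.
  rewrite mulr1 (@max_l _ _ (t - x)); last by lra.
  by rewrite /Num.max; case: ltP; lra.
- exact/summable_funZ/summable_below.
- by apply: (summable_funB); exact: summable_hinge.
Qed.

End Theory.

End PositiveFunctional.

(** * The gap between two functionals, and affinity of a stationary [h] where the gap is nonzero *)

Section Gap.
Context {R : realType}.
Implicit Types (A B : (R -> R) -> R) (f g h w : R -> R) (a b s t u v x y : R).

(** For measures this is the integral over [[0, s]] of the difference of their distribution
    functions. *)
Definition gap A B s : R := A (hinge s) - B (hinge s).

(** Variational inequality at an optimum: [A - B] is a positive multiple of the derivative at [h] of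
    the least squares criterion, and minus the derivative of the likelihood criterion. *)
Definition stationary A B h : Prop :=
  forall g, convex_cone g -> B g - B h <= A g - A h.

(** On [[0, s]] the part of [h] above its support line at [s], and 0 beyond; written with [below]
    and [hinge] so that linear functionals can be evaluated term by term. *)
Definition excess h s x : R :=
  below s x * h x - h s * below s x + rslope h s * hinge s x.

Lemma excess_left h s x : x <= s ->
  excess h s x = h x - h s - rslope h s * (x - s).
Proof.
by move=> xs; rewrite /excess below1// hinge_left//; ring.
Qed.

Lemma excess_right h s x : s <= x -> excess h s x = 0.
Proof.
rewrite le_eqVlt => /predU1P[<-|sx].
  by rewrite excess_left// !subrr mulr0 subr0.
by rewrite /excess below0// hinge_right ?ltW//; ring.
Qed.

Lemma summable_excess h s : summable_fun h -> summable_fun (excess h s).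
Proof.
move=> sh; apply: summable_funD.
  apply: summable_funB; first exact: summable_below_mul.
  exact/summable_funZ/summable_below.
exact/summable_funZ/summable_hinge.
Qed.

Section Cone.
Variable h : R -> R.
Hypothesis Kh : convex_cone h.

Let ch := proj1 Kh.

Lemma excess_ge0 s x : 0 < s -> 0 <= x -> 0 <= excess h s x.
Proof.
move=> s0 x0; have [sx|xs] := leP s x; first by rewrite excess_right.
rewrite excess_left ?(ltW xs)//; have := rslope_support ch s0 x0; lra.
Qed.

(** Left of [s] a support line has slope [rslope h x - rslope h s <= 0]; being at most 0 at [s], it
    stays below the zero function afterwards. *)
Lemma cone_excess s : 0 < s -> convex_cone (excess h s).
Proof.
move=> s0; split; last exact/summable_excess/cone_summable.
apply: convex_of_support_lines => x x0.
have [sx|xs] := leP s x.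
  by exists 0 => y y0; rewrite mul0r addr0 excess_right// excess_ge0.
exists (rslope h x - rslope h s) => y y0; rewrite excess_left ?(ltW xs)//.
have H1 := rslope_support ch x0 y0.
have [sy|ys] := leP s y; last by rewrite excess_left ?(ltW ys)//; lra.
rewrite excess_right//.
have H2 := rslope_support ch x0 (ltW s0).
have H3 := rslope_nondecreasing ch x0 (ltW xs).
have : (rslope h x - rslope h s) * (y - s) <= 0.
  by rewrite mulr_le0_ge0 ?subr_le0 ?subr_ge0.
lra.
Qed.

(** The difference is the support line at [s] up to [s] and [h] from there on, so slopes still
    increase. *)
Lemma cone_sub_excess s : 0 < s -> convex_cone (fun x => h x - excess h s x).
Proof.
move=> s0; split; last first.
  by apply: summable_funB; [|apply: summable_excess]; exact: cone_summable.
apply: convex_of_support_lines => x x0.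
have [xs|sx] := leP x s.
  exists (rslope h s) => y y0; rewrite excess_left//.
  have := rslope_support ch s0 y0.
  by have [sy|ys] := leP s y; [rewrite excess_right//|rewrite excess_left ?(ltW ys)//]; lra.
exists (rslope h x) => y y0; rewrite (@excess_right _ _ x) ?(ltW sx)//.
have H1 := rslope_support ch x0 y0.
have [sy|ys] := leP s y; first by rewrite excess_right//; lra.
rewrite excess_left ?(ltW ys)//.
have H2 := rslope_support ch x0 (ltW s0).
have H3 := rslope_nondecreasing ch s0 (ltW sx).
have : (rslope h x - rslope h s) * (y - s) <= 0.
  by rewrite mulr_ge0_le0 ?subr_le0 ?subr_ge0// ltW.
lra.
Qed.

(** Left of [u] the increment is affine with slope [- (rslope h v - rslope h u)], and its value at
    [u] is [excess h v u >= 0]. *)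
Lemma excess_increment_ge u v x : 0 < u -> u < v -> 0 <= x ->
  (rslope h v - rslope h u) * hinge u x <= excess h v x - excess h u x.
Proof.
move=> u0 uv x0; have v0 : 0 < v by lra.
have [ux|xu] := leP u x.
  rewrite (excess_right h ux) subr0 hinge_right// mulr0.
  exact: excess_ge0.
rewrite !excess_left; [|lra..].
rewrite hinge_left ?(ltW xu)//.
have := rslope_support ch v0 (ltW u0); lra.
Qed.

(** Between [u] and [v] the bound amounts to [h x + rslope h u * (v - x) <= h v], true because the
    slope at [x] is at least the slope at [u]; left of [u] it is the support line at [u] evaluated
    at [v]. *)
Lemma excess_increment_le u v x : 0 < u -> u < v -> 0 <= x ->
  excess h v x - excess h u x <= (rslope h v - rslope h u) * hinge v x.
Proof.
move=> u0 uv x0; have v0 : 0 < v by lra.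
have Hr := rslope_nondecreasing ch u0 (ltW uv).
have [vx|xv] := leP v x.
  rewrite !excess_right; [|lra..].
  by rewrite subrr mulr_ge0 ?hinge_ge0// subr_ge0.
rewrite (excess_left h (ltW xv)) hinge_left ?(ltW xv)//.
have [ux|xu] := leP u x.
  rewrite excess_right//.
  have := rslope_support ch u0 (ltW v0).
  have x0' : 0 < x by lra.
  have := rslope_support ch u0 x0.
  have := rslope_support ch x0' (ltW v0).
  have := ler_wpM2r (_ : 0 <= v - x) (rslope_nondecreasing ch u0 ux).
  by rewrite subr_ge0 => /(_ (ltW xv)); lra.
rewrite (excess_left h (ltW xu)).
have := rslope_support ch u0 (ltW v0); lra.
Qed.

Section Stationary.
Variables (A B : (R -> R) -> R) (M C : R).
Hypotheses (pA : positive_functional A) (pB : positive_functional B).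
Hypothesis M0 : 0 <= M.
Hypothesis A_lip : forall s t, 0 <= s -> s <= t ->
  A (below t) - A (below s) <= M * (t - s).
Hypothesis C0 : 0 <= C.
Hypothesis B_le : forall s, B (below s) <= C.
Hypothesis statAB : stationary A B h.

Lemma stationary_ge g : convex_cone g -> B g <= A g.
Proof.
move=> Kg; have := statAB (coneD Kh Kg).
rewrite (functionalD pA) ?(functionalD pB); try exact: cone_summable.
lra.
Qed.

Lemma gap_ge0 s : 0 <= gap A B s.
Proof. by rewrite /gap subr_ge0; exact/stationary_ge/cone_hinge. Qed.

Lemma stationary_excess s : 0 < s -> A (excess h s) = B (excess h s).
Proof.
move=> s0; apply/eqP; rewrite eq_le stationary_ge ?andbT; last exact: cone_excess.
have := statAB (cone_sub_excess s0).
have sh := cone_summable Kh; have se := summable_excess s sh.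
rewrite (functionalB pA)// (functionalB pB)//. lra.
Qed.

Lemma gap0 : gap A B 0 = 0.
Proof. by rewrite /gap !functional_hinge0// subrr. Qed.

Lemma gap_increment_ge s t : s <= t ->
  (t - s) * (A (below s) - B (below t)) <= gap A B t - gap A B s.
Proof.
move=> st; have := functional_hinge_ge pA st.
by have := functional_hinge_le pB st; rewrite /gap; lra.
Qed.

Lemma gap_increment_le s t : s <= t ->
  gap A B t - gap A B s <= (t - s) * (A (below t) - B (below s)).
Proof.
move=> st; have := functional_hinge_le pA st.
by have := functional_hinge_ge pB st; rewrite /gap; lra.
Qed.

Lemma functional_below_ge0 (D : (R -> R) -> R) s : positive_functional D ->
  0 <= D (below s).
Proof.
by move=> pD; apply: functional_ge0 => //; exact: summable_below.
Qed.

Lemma gap_lipschitz p s t : 0 <= s -> s <= t -> t <= p ->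
  `|gap A B t - gap A B s| <= (A (below p) + C) * (t - s).
Proof.
move=> s0 st tp; rewrite ler_norml.
have H1 := gap_increment_le st; have H2 := gap_increment_ge st.
have At := functional_below_le pA tp.
have Bt := B_le t.
have As := functional_below_ge0 s pA.
have Bs := functional_below_ge0 s pB.
have ts : 0 <= t - s by lra.
have := ler_wpM2r ts Bt; have := ler_wpM2r ts At.
have := mulr_ge0 ts As; have := mulr_ge0 ts Bs.
have := ler_wpM2r ts (functional_below_ge0 p pA).
have := mulr_ge0 ts C0.
by move=> *; apply/andP; split; lra.
Qed.

(* At a zero the nonnegative function [gap] is minimal; its one-sided
   derivatives there are differences of masses. *)
Lemma gap0_mass_eq s : 0 < s -> gap A B s = 0 -> A (below s) = B (below s).
Proof.
move=> s0 gs; apply/eqP; rewrite eq_le; apply/andP; split.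
  apply: (@le_epsilon_linear _ _ _ M s) => // e e0 es.
  have se : s - e <= s by lra.
  have := gap_increment_ge se; rewrite gs sub0r (_ : s - (s - e) = e); last by ring.
  move=> H1; have H2 := gap_ge0 (s - e).
  have : e * (A (below (s - e)) - B (below s)) <= 0 by lra.
  rewrite pmulr_rle0// => H3.
  have := @A_lip (s - e) s; rewrite (_ : s - (s - e) = e); last by ring.
  by move=> /(_ ltac:(lra) se); lra.
apply: (@le_epsilon_linear _ _ _ M 1) => // e e0 _.
have se : s <= s + e by lra.
have := gap_increment_le se; rewrite gs subr0 (_ : s + e - s = e); last by ring.
move=> H1; have H2 := gap_ge0 (s + e).
have : 0 <= e * (A (below (s + e)) - B (below s)) by lra.
rewrite pmulr_rge0// => H3.
have := @A_lip s (s + e); rewrite (_ : s + e - s = e); last by ring.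
by move=> /(_ (ltW s0) se); lra.
Qed.

(* [excess h v - excess h u] lies between the multiples by the slope jump of
   the two hinges at [u] and [v], and [A] and [B] agree on it. *)
Lemma gap_le_of_rslope_lt u v : 0 < u -> u < v -> rslope h u < rslope h v ->
  gap A B u <= (v - u) * C.
Proof.
move=> u0 uv; rewrite -subr_gt0; set k := _ - _ => k0.
have v0 : 0 < v by lra.
have sh := cone_summable Kh.
have se s := summable_excess s sh.
have seB : summable_fun (fun x => excess h v x - excess h u x).
  by apply: summable_funB; exact: se.
have skh s : summable_fun (fun x => k * hinge s x).
  exact/summable_funZ/summable_hinge.
have HA : k * A (hinge u) <= A (excess h v) - A (excess h u).
  rewrite -(functionalZ pA) -?(functionalB pA)//; last exact: summable_hinge.
  by apply: (le_functional pA) => // x x0; exact: excess_increment_ge.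
have HB : B (excess h v) - B (excess h u) <= k * B (hinge v).
  rewrite -(functionalZ pB) -?(functionalB pB)//; last exact: summable_hinge.
  by apply: (le_functional pB) => // x x0; exact: excess_increment_le.
have : A (hinge u) <= B (hinge v).
  by rewrite -(ler_pM2l k0) (le_trans HA)// !stationary_excess.
have := functional_hinge_le pB (ltW uv).
have := ler_wpM2l (_ : 0 <= v - u) (B_le v); rewrite subr_ge0 => /(_ (ltW uv)).
by rewrite /gap; lra.
Qed.

Lemma rslope_constant a b u v : 0 <= a ->
  (forall s, a < s -> s < b -> gap A B s <> 0) ->
  a < u -> u <= v -> v < b -> rslope h v = rslope h u.
Proof.
move=> a0 gN0 au uv vb; apply: locally_constant => // s us sv.
have gs : 0 < gap A B s.
  by rewrite lt_neqAle gap_ge0 andbT eq_sym; apply/eqP/gN0; lra.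
have [L LE L0] : exists2 L, L = A (below b) + C & 0 <= L.
  by exists (A (below b) + C); rewrite // addr_ge0// functional_below_ge0.
have D0 : 0 < L + C + 1 by move: C0 L0; lra.
(* A slope change between [s] and [t] bounds the gap at the smaller of the two points by [C] times
   their distance. If that point is [t], the Lipschitz constant [L] carries the bound to [s]; either
   way this radius is too small for it. *)
exists (gap A B s / (L + C + 1)); first exact: divr_gt0.
move=> t ut tv; rewrite ltr_pdivlMr// => Hts.
have [st|ts|->//] := ltgtP s t.
  apply/eqP; rewrite eq_le (rslope_nondecreasing ch _ (ltW st)); last by lra.
  rewrite andbT leNgt; apply/negP => lt_slope.
  have := gap_le_of_rslope_lt _ st lt_slope => /(_ ltac:(lra)).
  move: Hts; rewrite gtr0_norm ?subr_gt0// => Hts.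
  have := mulr_ge0 (_ : 0 <= t - s) L0; rewrite subr_ge0 => /(_ (ltW st)).
  lra.
apply/eqP; rewrite eq_le (rslope_nondecreasing ch _ (ltW ts))/=; last by lra.
rewrite leNgt; apply/negP => lt_slope.
have := gap_le_of_rslope_lt _ ts lt_slope => /(_ ltac:(lra)).
have := @gap_lipschitz b t s _ (ltW ts) _ => /(_ ltac:(lra) ltac:(lra)).
rewrite ler_norml => /andP[_].
move: Hts; rewrite distrC gtr0_norm ?subr_gt0// -LE => Hts; lra.
Qed.

(** With equal right slopes at [u] and [v], the two support inequalities are opposite to each
    other. *)
Lemma cone_affine a b u v : 0 <= a ->
  (forall s, a < s -> s < b -> gap A B s <> 0) ->
  a < u -> u < b -> a < v -> v < b -> h v = h u + rslope h u * (v - u).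
Proof.
move=> a0 gN0 au ub av vb.
have e : rslope h v = rslope h u.
  have [uv|vu] := leP u v; first exact: (rslope_constant a0 gN0).
  by apply/esym/(rslope_constant a0 gN0) => //; exact: ltW.
have u0 : 0 < u by lra.
have v0 : 0 < v by lra.
have := rslope_support ch u0 (ltW v0); have := rslope_support ch v0 (ltW u0).
by rewrite e; lra.
Qed.

End Stationary.

End Cone.

End Gap.

(** * First-order conditions for the two estimators *)

Section Optimality.
Context {R : realType} {n : nat}.
Notation mu := (@lebesgue_measure R).
Notation H := (`[0%R, +oo[%classic : set R).
Variable x : 'I_n -> R.
Hypothesis n_gt0 : (0 < n)%N.
Hypothesis x_ge0 : forall i, 0 <= x i.
Implicit Types (f g h : R -> R) (s t : R).

Let nR_gt0 : 0 < n%:R :> R. Proof. by rewrite ltr0n. Qed.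

Lemma summable_fun_EFin g : summable_fun g ->
  (\int[mu]_(t in H) (g t)%:E = (half_int g)%:E)%E.
Proof. by move=> sg; rewrite /half_int /Rintegral fineK// integrable_fin_num. Qed.

Lemma sampled_edf s : sampled (fun=> n%:R^-1) x (below s) = edf x s.
Proof.
rewrite /sampled -mulr_sumr /edf -sum1dep_card natr_sum [in RHS]big_mkcond/=.
by congr (_ * _); apply: eq_bigr => i _; rewrite /below; case: ifP.
Qed.

Lemma edf_integral_EFin g :
  edf_integral x (fun t => (g t)%:E) = (sampled (fun=> n%:R^-1) x g)%:E.
Proof. by rewrite /edf_integral sumEFin -EFinM /sampled mulr_sumr. Qed.

Lemma cone_segment f g t : convex_cone f -> convex_cone g -> 0 <= t <= 1 ->
  convex_cone (fun y => (1 - t) * f y + t * g y).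
Proof. by move=> Kf Kg /andP[t0 t1]; apply: coneD; apply: coneZ => //; lra. Qed.

Lemma cone_summableM f g : convex_cone f -> convex_cone g ->
  summable_fun (fun y => f y * g y).
Proof.
move=> Kf Kg; apply: (summable_funM (cone_measurable Kf) (cone_norm_le Kf)).
exact: cone_summable.
Qed.

Lemma ls_criterionE h : convex_cone h ->
  ls_criterion x h =
  (half_int (fun t => h t * h t) - 2 * sampled (fun=> n%:R^-1) x h)%:E.
Proof.
move=> Kh; rewrite /ls_criterion edf_integral_EFin EFinB EFinM.
by rewrite -(summable_fun_EFin (cone_summableM Kh Kh)).
Qed.

(** Along the segment from [h] to [g] the criterion is a quadratic polynomial in [t]; optimality at
    [t = 0] makes its linear coefficient nonnegative. *)
Lemma ls_stationary h : is_ls_estimator x h ->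
  stationary (weighted h) (sampled (fun=> n%:R^-1) x) h.
Proof.
move=> [Kh opt] g Kg.
have shh := cone_summableM Kh Kh; have shg := cone_summableM Kh Kg.
have sgg := cone_summableM Kg Kg.
set S := sampled _ _.
have pS : positive_functional S by apply: sampled_positive.
(* This is the integral of [(g - h) ^+ 2], the coefficient of [t ^+ 2]. *)
have sq0 : 0 <= half_int (fun y => g y * g y) + half_int (fun y => h y * h y)
    - 2 * weighted h g.
  rewrite -half_intD// -half_intZ// -half_intB//; last 2 first.
    exact: summable_funD.
    exact: summable_funZ.
  by apply: Rintegral_ge0 => y _ /=; have := sqr_ge0 (g y - h y); lra.
apply: (@le_epsilon_linear _ _ _ ((half_int (fun y => g y * g y) +
    half_int (fun y => h y * h y) - 2 * weighted h g) / 2) 1) => //.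
  by rewrite divr_ge0.
move=> t t0 t1.
have Kt : convex_cone (fun y => (1 - t) * h y + t * g y).
  by apply: cone_segment => //; lra.
have := opt _ Kt; rewrite !ls_criterionE// lee_fin -/S.
rewrite (functionalD pS); try (apply: summable_funZ; exact: cone_summable).
rewrite !(functionalZ pS); try exact: cone_summable.
have -> : half_int (fun y => ((1 - t) * h y + t * g y) * ((1 - t) * h y + t * g y))
  = (1 - t) ^+ 2 * half_int (fun y => h y * h y) + (2 * t * (1 - t) * weighted h g
    + t ^+ 2 * half_int (fun y => g y * g y)).
  rewrite /weighted -half_intZ// -(half_intZ (2 * t * (1 - t)))//.
  rewrite -(half_intZ (t ^+ 2))// -half_intD; try exact: summable_funZ.
  rewrite -half_intD; [|exact: summable_funZ|]; last first.
    by apply: summable_funD; exact: summable_funZ.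
  by apply: eq_half_int => y _; ring.
rewrite -[weighted h h]/(half_int (fun y => h y * h y)).
move: (half_int _) (half_int _) (weighted h g) (S h) (S g) sq0 => a b c d e sq0.
by move=> HH; rewrite -(ler_pM2l t0); nra.
Qed.

Lemma edf_integral_lne h : (forall i, 0 < h (x i)) ->
  edf_integral x (fun t => lne (h t)%:E) =
  (n%:R^-1 * \sum_(i < n) ln (h (x i)))%:E.
Proof.
move=> h0; rewrite /edf_integral EFinM -sumEFin; congr (_ * _)%E.
by apply: eq_bigr => i _; rewrite lne_EFin.
Qed.

Lemma ml_criterionE h : convex_cone h -> (forall i, 0 < h (x i)) ->
  ml_criterion x h =
  (n%:R^-1 * \sum_(i < n) ln (h (x i)) - half_int h)%:E.
Proof.
move=> Kh h0; rewrite /ml_criterion edf_integral_lne// EFinB.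
by rewrite summable_fun_EFin//; exact: cone_summable.
Qed.

(** A zero at an observation makes the criterion [-oo], whereas a hinge placed to the right of the
    whole sample has a finite criterion. *)
Lemma ml_positive h : is_ml_estimator x h -> forall i, 0 < h (x i).
Proof.
move=> [Kh opt] i; rewrite ltNge; apply/negP => hi.
have x_lt j : x j < 1 + \sum_(k < n) x k.
  rewrite (bigD1 j)//= addrCA ltrDl.
  by apply: (@lt_le_trans _ _ 1) => //; rewrite lerDl sumr_ge0.
have := opt _ (cone_hinge (1 + \sum_(k < n) x k)).
rewrite ml_criterionE; [|exact: cone_hinge|]; last first.
  by move=> j; rewrite hinge_left ?subr_gt0// ltW.
suff -> : ml_criterion x h = -oo%E by rewrite leeNy_eq.
rewrite /ml_criterion /edf_integral (bigD1 i)//= hi.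
by rewrite addNye gt0_muleNy ?lte_fin ?invr_gt0// addNye.
Qed.

Lemma ml_stationary h : is_ml_estimator x h ->
  stationary (weighted (fun=> 1)) (sampled (fun i => (n%:R * h (x i))^-1) x) h.
Proof.
move=> est g Kg; have h0 := ml_positive est; case: est => Kh opt.
have w1 f : weighted (fun=> 1) f = half_int f.
  by apply: eq_half_int => y _; rewrite mul1r.
rewrite !w1.
set L := n%:R^-1 * \sum_(i < n) 2 * ((g (x i) - h (x i)) / h (x i)) ^+ 2.
have L0 : 0 <= L.
  rewrite mulr_ge0 ?invr_ge0 ?ler0n// sumr_ge0// => i _.
  by rewrite mulr_ge0// sqr_ge0.
apply: (@le_epsilon_linear _ _ _ L (2^-1)) => //.
move=> t t0 t1.
have {}t1 : t <= 1 / 2 by lra.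
have Kt : convex_cone (fun y => (1 - t) * h y + t * g y).
  by apply: cone_segment => //; lra.
pose k i := (1 - t) * h (x i) + t * g (x i).
have g0 i : 0 <= g (x i) by exact: cone_ge0.
have k0 i : 0 < k i.
  by rewrite ltr_pwDl// ?mulr_gt0 ?mulr_ge0//; lra.
have := opt _ Kt; rewrite !ml_criterionE// lee_fin.
rewrite half_intD; try (apply: summable_funZ; exact: cone_summable).
rewrite !half_intZ; try exact: cone_summable.
(* The logarithm of [k / h] is at least [1 - h / k], which agrees with [t * (g - h) / h] to first
   order. The factor 2 bounds [h / k], because [k >= (1 - t) * h] and [t <= 1 / 2]. *)
have ln_ge i : t * ((g (x i) - h (x i)) / h (x i)
    - t * (2 * ((g (x i) - h (x i)) / h (x i)) ^+ 2)) <= ln (k i) - ln (h (x i)).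
  have hi := h0 i; have hN : h (x i) != 0 by rewrite gt_eqF.
  have kN : k i != 0 by rewrite gt_eqF.
  have hk : 0 < h (x i) / k i by exact: divr_gt0.
  have := @le_ln1Dx R (h (x i) / k i - 1); rewrite (addrC 1) subrK ltrBrDl subrr.
  move=> /(_ hk); rewrite ln_div ?posrE// => Hln.
  suff : t * ((g (x i) - h (x i)) / h (x i)
    - t * (2 * ((g (x i) - h (x i)) / h (x i)) ^+ 2)) <= 1 - h (x i) / k i by lra.
  have -> : 1 - h (x i) / k i = t * (g (x i) - h (x i)) / k i.
    by rewrite /k; field; exact: kN.
  rewrite -mulrA ler_pM2l//.
  have -> : (g (x i) - h (x i)) / k i = (g (x i) - h (x i)) / h (x i)
     - t * ((g (x i) - h (x i)) / h (x i)) ^+ 2 * (h (x i) / k i).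
    by rewrite /k; field; rewrite hN ?andbT; exact: kN.
  rewrite lerD2l lerN2 -mulrA ler_pM2l// mulrC ler_wpM2r ?sqr_ge0//.
  rewrite ler_pdivrMr// /k; have := g0 i; nra.
have : \sum_(i < n) t * ((g (x i) - h (x i)) / h (x i)
    - t * (2 * ((g (x i) - h (x i)) / h (x i)) ^+ 2)) <=
  \sum_(i < n) (ln (k i) - ln (h (x i))) by apply: ler_sum.
rewrite -mulr_sumr !sumrB -mulr_sumr => Hsum Hopt.
have nV0 : 0 < n%:R^-1 :> R by rewrite invr_gt0.
have -> : sampled (fun i => (n%:R * h (x i))^-1) x g -
   sampled (fun i => (n%:R * h (x i))^-1) x h =
   n%:R^-1 * \sum_(i < n) (g (x i) - h (x i)) / h (x i).
  rewrite /sampled -sumrB mulr_sumr; apply: eq_bigr => i _.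
  by rewrite -mulrBr invfM mulrC mulrCA mulrA.
rewrite -(ler_pM2l t0).
have := ler_wpM2l (ltW nV0) Hsum.
rewrite /L; move: Hopt; rewrite /k.
lra.
Qed.

End Optimality.

(** * Affine pieces of a cone element: the unbounded piece and the right endpoint *)

Section Tail.
Context {R : realType}.
Variable h : R -> R.
Hypothesis Kh : convex_cone h.
Implicit Types (a b u v : R).

Lemma rslope_le0 u : 0 < u -> rslope h u <= 0.
Proof.
move=> u0; have u1 : 0 <= u + 1 by lra.
have := rslope_support (proj1 Kh) u0 u1.
have := cone_nonincreasing Kh (ltW u0) (_ : u <= u + 1).
by move=> /(_ ltac:(lra)); lra.
Qed.

(** On a half-line, an affine function with negative slope becomes negative and a positive constant
    is not integrable. *)
Lemma cone_affine_tail a : 0 <= a ->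
  (forall u v, a < u -> a < v -> h v = h u + rslope h u * (v - u)) ->
  forall u, a < u -> h u = 0.
Proof.
move=> a0 aff u au; have u0 : 0 < u by lra.
have hu0 := cone_ge0 Kh (ltW u0).
have r0 : rslope h u = 0.
  apply/eqP; rewrite eq_le rslope_le0//= leNgt; apply/negP => r0.
  (* At [u + d] the line takes the value [-1]. *)
  pose d := (h u + 1) / - rslope h u.
  have d0 : 0 < d by rewrite divr_gt0 ?oppr_gt0//; lra.
  have := aff u (u + d) au ltac:(lra).
  rewrite (_ : rslope h u * (u + d - u) = - (h u + 1)); last first.
    by rewrite /d; field; rewrite lt_eqF.
  by have := cone_ge0 Kh (_ : 0 <= u + d); move=> /(_ ltac:(lra)); lra.
apply/eqP; rewrite eq_le hu0 andbT leNgt; apply/negP => hu.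
apply: (no_positive_tail (cone_summable Kh) hu (a := u)) => v uv.
by rewrite (aff u v au ltac:(lra)) r0 mul0r addr0.
Qed.

(** The support line at [b] bounds [h b] by [h (b - e)] plus a term linear in [e], so the affine
    formula extends to the endpoint [b]. *)
Lemma cone_affine_closure a b u : 0 <= a ->
  (forall u v, a < u -> u < b -> a < v -> v < b ->
     h v = h u + rslope h u * (v - u)) ->
  a < u -> u < b -> h b = h u + rslope h u * (b - u).
Proof.
move=> a0 aff au ub; have u0 : 0 < u by lra.
have b0 : 0 < b by lra.
apply/eqP; rewrite eq_le (rslope_support (proj1 Kh) u0 (ltW b0)) andbT.
apply: (@le_epsilon_linear _ _ _ `|rslope h b - rslope h u| (b - u)) => //.
  by rewrite subr_gt0.
move=> e e0 eb.
have ve : 0 <= b - e by lra.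
have := rslope_support (proj1 Kh) b0 ve.
have [->|eNb] := eqVneq e (b - u).
  rewrite (_ : b - (b - u) = u); last by ring.
  have := ler_wpM2r (_ : 0 <= b - u) (ler_norm (rslope h b - rslope h u)).
  by move=> /(_ ltac:(lra)); lra.
have eb' : e < b - u by rewrite lt_neqAle eNb.
rewrite (aff u (b - e)); [|lra..].
have := ler_wpM2r (ltW e0) (ler_norm (rslope h b - rslope h u)); lra.
Qed.

End Tail.

(** * From the likelihood conditions to the fitted and empirical distribution functions *)

Section MaximumLikelihood.
Context {R : realType} {n : nat}.
Variables (x : 'I_n -> R) (h : R -> R).
Hypothesis n_gt0 : (0 < n)%N.
Hypothesis x_gt0 : forall i, 0 < x i.
Hypothesis Kh : convex_cone h.
Hypothesis h_gt0 : forall i, 0 < h (x i).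
Implicit Types (a b r s y : R) (g : R -> R).

Notation A := (weighted (fun=> 1 : R)).
Notation B := (sampled (fun i => (n%:R * h (x i))^-1) x).
Notation Ah := (weighted h).
Notation E := (sampled (fun=> n%:R^-1) x).

Hypothesis statAB : stationary A B h.

Lemma lebesgue_positive : positive_functional (A : (R -> R) -> R).
Proof. by apply: (@weighted_positive _ _ 1) => // y _; rewrite ler01 lexx. Qed.

Lemma weightedE g : A g = half_int g.
Proof. by apply: eq_half_int => y _; rewrite mul1r. Qed.

Lemma likelihood_positive : positive_functional B.
Proof.
apply: sampled_positive => i; last exact: ltW.
by rewrite invr_ge0 mulr_ge0// ltW.
Qed.

(** Together with [sampled_mul]: multiplying test functions by [h] turns the pair [A], [B] of the
    likelihood conditions into the fitted measure [Ah] and the empirical measure [E]. *)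
Lemma weighted_mul g : Ah g = A (fun y => h y * g y).
Proof. by rewrite weightedE. Qed.

Lemma sampled_mul g : E g = B (fun y => h y * g y).
Proof.
apply: eq_bigr => i _; rewrite invfM mulrA -[_ * _ * h _]mulrA mulVf ?gt_eqF//.
by rewrite mulr1.
Qed.

(** [A] and [B] agree on [excess h a], on [below a] and on [hinge a], hence on the remaining term
    [below a * h] of the excess. *)
Lemma ml_mass_eq a : 0 < a -> gap A B a = 0 -> A (below a) = B (below a) ->
  Ah (below a) = E (below a).
Proof.
move=> a0 ga mass_eq; rewrite weighted_mul sampled_mul.
have pA := lebesgue_positive; have pB := likelihood_positive.
have sh := cone_summable Kh.
have sb : summable_fun (fun y => below a y * h y) by exact: summable_below_mul.
have s1 : summable_fun (fun y => h a * below a y).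
  exact/summable_funZ/summable_below.
have s2 : summable_fun (fun y => rslope h a * hinge a y).
  exact/summable_funZ/summable_hinge.
have s3 : summable_fun (fun y => below a y * h y - h a * below a y).
  exact: summable_funB.
have e1 D : positive_functional D ->
    D (excess h a) = D (fun y => h y * below a y) - h a * D (below a)
      + rslope h a * D (hinge a).
  move=> pD; rewrite /excess (functionalD pD)// (functionalB pD)//.
  rewrite !(functionalZ pD); try exact: summable_hinge; try exact: summable_below.
  by congr (_ - _ + _); apply: (eq_functional pD) => // y _; rewrite mulrC.
have := stationary_excess Kh pA pB statAB a0.
rewrite !e1// mass_eq; move/eqP: ga; rewrite subr_eq0 => /eqP ->; lra.
Qed.

(** For [a <= r]: affine up to [a], the parabola [(r - y) ^+ 2] on [[a, r]], and 0 beyond; a convex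
    test function curved only on [[a, r]]. *)
Definition hinge2 a r y : R := hinge r y * hinge r y - hinge a y * hinge a y.

Lemma cone_hinge2 a r : 0 <= a -> a <= r -> convex_cone (hinge2 a r).
Proof.
move=> a0 ar; split; last first.
  by apply: summable_funB; apply: cone_summableM; exact: cone_hinge.
have hl y : y <= a -> hinge2 a r y = (r - a) * (r + a - 2 * y).
  by move=> ya; rewrite /hinge2 !hinge_left; [ring|lra..].
have hm y : a <= y -> y <= r -> hinge2 a r y = (r - y) ^+ 2.
  by move=> ay yr; rewrite /hinge2 hinge_left// hinge_right//; ring.
have hr y : r <= y -> hinge2 a r y = 0.
  by move=> ry; rewrite /hinge2 !hinge_right; [ring|lra..].
apply: convex_of_support_lines => y y0.
have [ya|ay] := leP y a; [|have [yr|ry] := leP y r].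
- exists (- (2 * (r - a))) => z z0; rewrite (hl y)//.
  have [za|az] := leP z a; first by rewrite hl//; lra.
  have [zr|rz] := leP z r.
    by rewrite (hm _ (ltW az) zr); have := sqr_ge0 (z - a); lra.
  rewrite (hr _ (ltW rz)); nra.
- exists (- (2 * (r - y))) => z z0; rewrite (hm _ (ltW ay) yr).
  have [za|az] := leP z a; first by rewrite hl//; nra.
  have [zr|rz] := leP z r.
    by rewrite (hm _ (ltW az) zr); have := sqr_ge0 (z - y); lra.
  rewrite (hr _ (ltW rz)); nra.
- exists 0 => z z0; rewrite (hr _ (ltW ry)) mul0r addr0.
  have [za|az] := leP z a; first by rewrite hl//; nra.
  have [zr|rz] := leP z r; first by rewrite (hm _ (ltW az) zr) sqr_ge0.
  by rewrite (hr _ (ltW rz)).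
Qed.

(* On [a, r] the function [h] is affine and nonincreasing, so that [h] times
   the hinge at [r] differs there from a convex function only by affine terms,
   on which [A] and [B] agree. *)
Lemma ml_gap_le a b r : 0 <= a -> gap A B a = 0 -> A (below a) = B (below a) ->
  Ah (below a) = E (below a) ->
  (forall u v, a < u -> u < b -> a < v -> v < b ->
     h v = h u + rslope h u * (v - u)) ->
  a < r -> r < b -> gap Ah E a <= gap Ah E r.
Proof.
move=> a0 ga mass_eq edf_eq aff ar rb.
have r0 : 0 < r by lra.
have pA := lebesgue_positive; have pB := likelihood_positive.
have sh := cone_summable Kh.
have Kt := cone_hinge2 a0 (ltW ar).
have sk := summable_hinge; have sb := summable_below.
set k := - rslope h r; have k0 : 0 <= k by rewrite oppr_ge0 rslope_le0.
have hr0 : 0 <= h r by rewrite (cone_ge0 Kh)// ltW.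
(* The function [psi] below is [h y * (r - y)] on []a, r]] and 0 elsewhere. Up to [a], the
   combination [h r * hinge r + k * hinge2 a r] equals [c1 + c2 * (a - y)], which must be subtracted
   there. *)
pose c1 := h r * (r - a) + k * (r - a) ^+ 2.
pose c2 := h r + 2 * k * (r - a).
pose psi y := h y * (hinge r y - hinge a y - (r - a) * below a y).
have psiE y : 0 <= y ->
    psi y = h r * hinge r y + k * hinge2 a r y - c2 * hinge a y - c1 * below a y.
  move=> y0; rewrite /psi /hinge2 /c1 /c2.
  have [ya|ay] := leP y a.
    by rewrite below1// !hinge_left ?(le_trans ya (ltW ar))//; ring.
  rewrite below0// (hinge_right (ltW ay)).
  have [yr|ry] := leP y r; last by rewrite hinge_right ?ltW//; ring.
  rewrite hinge_left// (aff r y); [|lra..].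
  by rewrite /k; ring.
have sm g : convex_cone g -> summable_fun (fun y => h y * g y).
  exact: cone_summableM.
have shr := sm _ (cone_hinge r); have sha := sm _ (cone_hinge a).
have shb : summable_fun (fun y => h y * below a y).
  by apply: (summable_funM (cone_measurable Kh) (cone_norm_le Kh)); exact: sb.
have shb' := summable_funZ (r - a) shb.
have sha' := summable_funB shr sha.
have e1 D : positive_functional D -> D psi = D (fun y => h y * hinge r y)
    - D (fun y => h y * hinge a y) - (r - a) * D (fun y => h y * below a y).
  move=> pD; rewrite -(functionalZ pD _ shb) -(functionalB pD shr sha).
  rewrite -(functionalB pD sha' shb').
  apply/esym/(eq_functional pD) => [|y _]; last by rewrite /psi; ring.
  exact: summable_funB.
have e2 D : positive_functional D -> D psi = h r * D (hinge r)
    + k * D (hinge2 a r) - c2 * D (hinge a) - c1 * D (below a).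
  move=> pD.
  have t1 := summable_funZ (h r) (sk R r).
  have t2 := summable_funZ k (cone_summable Kt).
  have t3 := summable_funZ c2 (sk R a).
  have t4 := summable_funZ c1 (sb R a).
  have t12 := summable_funD t1 t2; have t123 := summable_funB t12 t3.
  rewrite -(functionalZ pD _ (sk R r)) -(functionalZ pD _ (cone_summable Kt)).
  rewrite -(functionalZ pD _ (sk R a)) -(functionalZ pD _ (sb R a)).
  rewrite -(functionalD pD t1 t2) -(functionalB pD t12 t3).
  rewrite -(functionalB pD t123 t4).
  apply/esym/(eq_functional pD) => [|y y0]; last by rewrite psiE.
  exact: summable_funB.
have H1 : Ah (hinge r) - Ah (hinge a) - (r - a) * Ah (below a) = A psi.
  by rewrite (e1 _ pA) !weighted_mul.
have H2 : E (hinge r) - E (hinge a) - (r - a) * E (below a) = B psi.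
  by rewrite (e1 _ pB) !sampled_mul.
have H5 := stationary_ge Kh pA pB statAB (cone_hinge r).
have H6 := stationary_ge Kh pA pB statAB Kt.
have {}ga : A (hinge a) = B (hinge a) by apply/eqP; rewrite -subr_eq0; apply/eqP.
rewrite (e2 _ pA) ga mass_eq edf_eq in H1; rewrite (e2 _ pB) in H2.
have := ler_wpM2l hr0 H5; have := ler_wpM2l k0 H6.
rewrite /gap; move: H1 H2; lra.
Qed.

End MaximumLikelihood.

(** * Integrals of the test functions and of truncated quadratic polynomials *)

Section Moments.
Context {R : realType}.
Implicit Types (D : (R -> R) -> R) (a b p s t u v w x : R).

Lemma weighted_below_lipschitz (w : R -> R) M s t :
  measurable_fun (`[0%R, +oo[%classic : set R) w ->
  (forall x, 0 <= x -> 0 <= w x <= M) -> 0 <= s -> s <= t ->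
  weighted w (below t) - weighted w (below s) <= M * (t - s).
Proof.
move=> mw wM s0 st.
have sw u : summable_fun (fun x => w x * below u x).
  apply: (summable_funM mw _ (summable_below u)) => x x0.
  by have /andP[w0] := wM x x0; rewrite ger0_norm//; exact.
have sb u : summable_fun (below u) := summable_below u.
have sB := summable_funB (sb t) (sb s).
have -> : M * (t - s) = half_int (fun x => M * (below t x - below s x)).
  by rewrite half_intZ// half_intB// !half_int_below// (le_trans s0).
rewrite /weighted -half_intB//; apply: le_half_int.
- exact: summable_funB.
- exact: summable_funZ.
move=> x x0; rewrite -mulrBr ler_wpM2r//; last by have /andP[] := wM x x0.
rewrite subr_ge0 /below ler_nat; case: (leP x s) => // xs.
by rewrite (le_trans xs st).
Qed.

(** Increments of the left side lie between [(v - u) * u] and [(v - u) * v], so the difference of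
    the two sides is both nondecreasing and nonincreasing up to a quadratic defect. *)
Lemma half_int_hinge s : 0 <= s -> half_int (hinge s) = s ^+ 2 / 2.
Proof.
move=> s0; have pA := @lebesgue_positive R.
have H0 : half_int (hinge 0 : R -> R) = 0.
  by rewrite -weightedE functional_hinge0.
have inc u v : 0 <= u -> u <= v ->
   (v - u) * u <= half_int (hinge v) - half_int (hinge u) <= (v - u) * v.
  move=> u0 uv; have := functional_hinge_ge pA uv; have := functional_hinge_le pA uv.
  by rewrite !weightedE !half_int_below ?(le_trans u0 uv)// => -> ->.
apply/eqP; rewrite eq_le; apply/andP; split.
  have := @nondecreasing_of_quadratic_defect R
    (fun u => u ^+ 2 / 2 - half_int (hinge u)) 0 s 1 s0 ler01.
  rewrite H0 expr0n/= mul0r subr0 => HH; rewrite -subr_ge0; apply: HH.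
  move=> u v u0 uv vs; have /andP[_] := inc u v u0 uv; have := sqr_ge0 (v - u); lra.
have := @nondecreasing_of_quadratic_defect R
    (fun u => half_int (hinge u) - u ^+ 2 / 2) 0 s 1 s0 ler01.
rewrite H0 expr0n/= mul0r subr0 => HH; rewrite -subr_ge0; apply: HH.
move=> u v u0 uv vs; have /andP[+ _] := inc u v u0 uv; have := sqr_ge0 (v - u); lra.
Qed.

Lemma half_int_hinge2 s t : 0 <= s -> s <= t ->
  half_int (hinge2 s t) = (t ^+ 3 - s ^+ 3) / 3.
Proof.
move=> s0 st; have t0 := le_trans s0 st.
have sq u : summable_fun (fun x => hinge u x * hinge u x).
  by apply: cone_summableM; exact: cone_hinge.
suff H u : 0 <= u -> half_int (fun x => hinge u x * hinge u x) = u ^+ 3 / 3.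
  by rewrite /hinge2 half_intB// !H//; lra.
have H0 : half_int (fun x => hinge 0 x * hinge 0 x : R) = 0.
  rewrite (@eq_half_int _ _ (fun x => 0 * hinge 0 x)).
    by rewrite half_intZ ?mul0r//; exact: summable_hinge.
  by move=> x x0; rewrite hinge0// mul0r.
have inc v w : 0 <= v -> v <= w ->
   2 * (w - v) * (v ^+ 2 / 2) <= half_int (fun x => hinge w x * hinge w x)
     - half_int (fun x => hinge v x * hinge v x) <= 2 * (w - v) * (w ^+ 2 / 2).
  move=> v0 vw; have w0 := le_trans v0 vw.
  rewrite -!half_int_hinge// -!half_intZ; try exact: summable_hinge.
  rewrite -half_intB//.
  have hw x : 0 <= hinge w x - hinge v x <= w - v.
    have [xv|vx] := leP x v; first by rewrite !hinge_left//; lra.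
    rewrite (hinge_right (ltW vx)).
    by have [xw|wx] := leP x w; [rewrite hinge_left//|rewrite hinge_right ?(ltW wx)//]; lra.
  apply/andP; split; apply: le_half_int => //; try exact: summable_funB;
    try (apply: summable_funZ; exact: summable_hinge).
    move=> x x0; have [xv|vx] := leP x v.
      by rewrite !hinge_left ?(le_trans xv vw)//; have := sqr_ge0 (w - v); lra.
    by rewrite (hinge_right (ltW vx)) !mulr0 subr0 -expr2 sqr_ge0.
  move=> x x0; have /andP[h1 h2] := hw x; have hv := hinge_ge0 v x; nra.
move=> u0; apply/eqP; rewrite eq_le; apply/andP; split.
  (* The defect is [(w - v) ^+ 2] times a factor linear in [v] and [w], which [2 * u] dominates on
     [[0, u]]. *)
  have := @nondecreasing_of_quadratic_defect R
    (fun v => v ^+ 3 / 3 - half_int (fun x => hinge v x * hinge v x)) 0 u (2 * u) u0.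
  rewrite H0 expr0n/= mul0r subr0 => HH; rewrite -subr_ge0; apply: HH; first lra.
  move=> v w v0 vw wu; have /andP[_] := inc v w v0 vw.
  have : 0 <= (w - v) ^+ 2 * (2 * u - w) by rewrite mulr_ge0 ?sqr_ge0//; lra.
  have : 0 <= (w - v) ^+ 2 * v by rewrite mulr_ge0 ?sqr_ge0//.
  have : 0 <= (w - v) ^+ 2 * (w - v) by rewrite mulr_ge0 ?sqr_ge0//; lra.
  lra.
have := @nondecreasing_of_quadratic_defect R
    (fun v => half_int (fun x => hinge v x * hinge v x) - v ^+ 3 / 3) 0 u (2 * u) u0.
rewrite H0 expr0n/= mul0r subr0 => HH; rewrite -subr_ge0; apply: HH; first lra.
move=> v w v0 vw wu; have /andP[+ _] := inc v w v0 vw.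
have : 0 <= (w - v) ^+ 2 * (2 * u - w) by rewrite mulr_ge0 ?sqr_ge0//; lra.
have : 0 <= (w - v) ^+ 2 * v by rewrite mulr_ge0 ?sqr_ge0//.
have : 0 <= (w - v) ^+ 2 * (w - v) by rewrite mulr_ge0 ?sqr_ge0//; lra.
lra.
Qed.

(** A quadratic polynomial truncated to []a, b]]; powers of [b - x] make it a combination of
    [below], [hinge] and [hinge2], on which functionals can be evaluated. *)
Definition quad_on a b c0 c1 c2 x : R :=
  (below b x - below a x) * (c0 + c1 * (b - x) + c2 * (b - x) ^+ 2).

Lemma quad_on_in a b c0 c1 c2 x : a < x -> x <= b ->
  quad_on a b c0 c1 c2 x = c0 + c1 * (b - x) + c2 * (b - x) ^+ 2.
Proof. by move=> ax xb; rewrite /quad_on below1// below0// subr0 mul1r. Qed.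

Lemma quad_on_out a b c0 c1 c2 x : a <= b -> x <= a \/ b < x ->
  quad_on a b c0 c1 c2 x = 0.
Proof.
move=> ab [xa|bx]; rewrite /quad_on.
  by rewrite !below1 ?(le_trans xa ab)// subrr mul0r.
by rewrite !below0 ?(le_lt_trans ab bx)// subrr mul0r.
Qed.

Lemma quad_onE a b c0 c1 c2 x : a <= b ->
  quad_on a b c0 c1 c2 x = c0 * (below b x - below a x)
    + c1 * (hinge b x - hinge a x - (b - a) * below a x)
    + c2 * (hinge2 a b x - (b - a) ^+ 2 * below a x - 2 * (b - a) * hinge a x).
Proof.
move=> ab; have [xa|ax] := leP x a.
  rewrite quad_on_out//; last by left.
  by rewrite /hinge2 !below1 ?(le_trans xa ab)// !hinge_left ?(le_trans xa ab)//; ring.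
have [xb|bx] := leP x b.
  rewrite quad_on_in// /hinge2 below1// below0// hinge_left// hinge_right ?(ltW ax)//.
  by ring.
rewrite quad_on_out//; last by right.
rewrite /hinge2 !below0// !hinge_right ?(ltW ax) ?(ltW bx)//; ring.
Qed.

Lemma quad_on_functional a b c0 c1 c2 D : 0 <= a -> a <= b ->
  positive_functional D ->
  D (quad_on a b c0 c1 c2) = c0 * (D (below b) - D (below a))
    + c1 * (D (hinge b) - D (hinge a) - (b - a) * D (below a))
    + c2 * (D (hinge2 a b) - (b - a) ^+ 2 * D (below a) - 2 * (b - a) * D (hinge a)).
Proof.
move=> a0 ab pD; have sb u := @summable_below R u; have sh u := @summable_hinge R u.
have s2 := cone_summable (cone_hinge2 a0 ab).
have t0 := summable_funB (sb b) (sb a).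
have t1 := summable_funB (sh b) (sh a).
have t2 := summable_funZ (b - a) (sb a).
have t3 := summable_funB t1 t2.
have t4 := summable_funZ ((b - a) ^+ 2) (sb a).
have t5 := summable_funB s2 t4.
have t6 := summable_funZ (2 * (b - a)) (sh a).
have t7 := summable_funB t5 t6.
have u0 := summable_funZ c0 t0; have u1 := summable_funZ c1 t3.
have u2 := summable_funZ c2 t7; have u3 := summable_funD u0 u1.
rewrite -(functionalB pD (sb b) (sb a)) -(functionalB pD (sh b) (sh a)).
rewrite -!(functionalZ pD _ (sb a)) -(functionalB pD t1 t2).
rewrite -(functionalZ pD _ (sh a)) -(functionalB pD s2 t4) -(functionalB pD t5 t6).
rewrite -(functionalZ pD _ t0) -(functionalZ pD _ t3) -(functionalZ pD _ t7).
rewrite -(functionalD pD u0 u1) -(functionalD pD u3 u2).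
apply/esym/(eq_functional pD); first exact: summable_funD.
by move=> x x0; rewrite quad_onE.
Qed.

Lemma summable_quad_on a b c0 c1 c2 : 0 <= a -> a <= b ->
  summable_fun (quad_on a b c0 c1 c2).
Proof.
move=> a0 ab; have sb u := @summable_below R u; have sh u := @summable_hinge R u.
have s2 := cone_summable (cone_hinge2 a0 ab).
have t0 := summable_funB (sb b) (sb a).
have t3 := summable_funB (summable_funB (sh b) (sh a)) (summable_funZ (b - a) (sb a)).
have t7 := summable_funB (summable_funB s2 (summable_funZ ((b - a) ^+ 2) (sb a)))
  (summable_funZ (2 * (b - a)) (sh a)).
apply: summable_eq (summable_funD (summable_funD (summable_funZ c0 t0)
  (summable_funZ c1 t3)) (summable_funZ c2 t7)) => x x0.
by rewrite quad_onE.
Qed.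

Lemma half_int_quad_on a b c0 c1 c2 : 0 <= a -> a <= b ->
  half_int (quad_on a b c0 c1 c2) =
    c0 * (b - a) + c1 * (b - a) ^+ 2 / 2 + c2 * (b - a) ^+ 3 / 3.
Proof.
move=> a0 ab; have b0 := le_trans a0 ab.
rewrite -weightedE quad_on_functional//; last exact: lebesgue_positive.
rewrite !weightedE !half_int_below// !half_int_hinge// half_int_hinge2//; lra.
Qed.

End Moments.

(** * Bounds that propagate through regions where a function decreases *)

Section Descent.
Context {R : realType}.
Implicit Types (D e : R -> R) (a b p q s t L c : R).

(** Left of the infimum of the points where [c <= D], the function [e] is negative; hence [D]
    decreases from [p] up to that infimum, and [D p] is at least [c]. *)
Lemma ge_of_descent D e p b L c : p < b -> 0 <= L ->
  (forall s t, p <= s -> s <= t -> t <= b -> `|D t - D s| <= L * (t - s)) ->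
  (forall s t, p <= s -> s <= t -> t <= b ->
     (forall x, s <= x -> x <= t -> e x < 0) -> D t <= D s) ->
  c <= D b -> (forall q, p <= q -> q < b -> 0 <= e q -> c <= D q) ->
  c <= D p.
Proof.
move=> pb L0 Lip dec cb cq.
pose S := [set q | p <= q <= b /\ c <= D q].
have Sb : S b by split; rewrite ?lexx ?(ltW pb).
have hS : has_inf S by split; [exists b|exists p => q [/andP[]]].
have ip : p <= inf S by apply: lb_le_inf; [exists b|move=> q [/andP[]]].
have ib : inf S <= b by apply: (ge_inf hS.2).
apply: (@le_epsilon_linear _ _ _ (2 * L) 1) => //; first by rewrite mulr_ge0.
move=> d d0 _.
have [q [/andP[pq qb] cDq] qi] := inf_adherent d0 hS.
have iq : inf S <= q by apply: (ge_inf hS.2); split=> //; apply/andP.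
(* Stepping back by [d] keeps [[p, t]] inside the region [e < 0] unless [t = p]; the Lipschitz bound
   covers the distance, at most [2 * d], from [t] to [q]. *)
set t := Num.max p (inf S - d).
have pt : p <= t by rewrite le_max lexx.
have ti : t <= inf S by rewrite ge_max ip/= lerBlDr lerDl ltW.
have td : inf S - d <= t by rewrite le_max lexx orbT.
have tq := le_trans ti iq.
have tp : D t <= D p.
  have [->//|tNp] := eqVneq t p.
  have tlt : t < inf S.
    have : p < t by rewrite lt_neqAle eq_sym tNp.
    by rewrite {1}/t lt_max ltxx/= => H1; rewrite /t gt_max; apply/andP; split; lra.
  apply: dec => //; first exact: le_trans tq qb.
  move=> x px xt; rewrite ltNge; apply/negP => ex.
  have xb : x < b by apply: (le_lt_trans xt); apply: (lt_le_trans tlt).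
  have : inf S <= x.
    by apply: (ge_inf hS.2); split; [rewrite px ltW|exact: cq].
  by rewrite leNgt (le_lt_trans xt tlt).
have := Lip t q pt tq qb; rewrite ler_norml => /andP[_ H1].
have : L * (q - t) <= L * (2 * d) by rewrite ler_wpM2l//; lra.
lra.
Qed.

(** Mirror image of [ge_of_descent], applied to [- D (- s)]. *)
Lemma le_of_ascent D e a p L c : a < p -> 0 <= L ->
  (forall s t, a <= s -> s <= t -> t <= p -> `|D t - D s| <= L * (t - s)) ->
  (forall s t, a <= s -> s <= t -> t <= p ->
     (forall x, s <= x -> x <= t -> e x < 0) -> D t <= D s) ->
  D a <= c -> (forall q, a < q -> q <= p -> 0 <= e q -> D q <= c) ->
  D p <= c.
Proof.
move=> ap L0 Lip dec ca cq.
suff : - c <= - D (- - p) by rewrite opprK lerN2.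
apply: (@ge_of_descent (fun s => - D (- s)) (fun s => e (- s)) (- p) (- a) L) => //.
- by rewrite ltrN2.
- move=> s t ps st ta.
  rewrite (_ : t - s = - s - - t); last by ring.
  rewrite (_ : - D (- t) - - D (- s) = D (- s) - D (- t)); last by ring.
  by apply: Lip; lra.
- move=> s t ps st ta neg; rewrite lerN2; apply: dec; [lra..|] => x tx xs.
  by rewrite -[x]opprK; apply: neg; lra.
- by rewrite opprK lerN2.
- by move=> q pq qa eq; rewrite lerN2; apply: cq => //; lra.
Qed.

End Descent.

(** * Comparison of the fitted distribution function with that of [f] on one affine piece *)

Section Comparison.
Context {R : realType}.
Variables (h f : R -> R) (E : (R -> R) -> R) (m M : R).
Hypotheses (Kh : convex_cone h) (Kf : convex_cone f).
Hypothesis pE : positive_functional E.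

Notation Ph := (weighted h).
Notation Pf := (weighted f).

Hypothesis E_ge : forall s, 0 <= s -> m <= E (below s) - Pf (below s).
Hypothesis E_le : forall s, 0 <= s -> E (below s) - Pf (below s) <= M.
Implicit Types (a b p q r s t u v x : R) (g : R -> R).

Lemma cone_weighted_positive g : convex_cone g -> positive_functional (weighted g).
Proof.
move=> Kg; apply: (@weighted_positive _ _ (g 0)); first exact: cone_measurable.
by move=> x x0; rewrite cone_ge0// cone_le0.
Qed.

Lemma cone_weighted_lipschitz g s t : convex_cone g -> 0 <= s -> s <= t ->
  weighted g (below t) - weighted g (below s) <= g 0 * (t - s).
Proof.
move=> Kg; apply: weighted_below_lipschitz; first exact: cone_measurable.
by move=> x x0; rewrite cone_ge0// cone_le0.
Qed.

Let pPh := cone_weighted_positive Kh.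
Let pPf := cone_weighted_positive Kf.

(** Integrated form of [E_ge]; the Lipschitz bound on [Pf (below s)] makes the error of each
    increment quadratic. *)
Lemma gap_lower a p : 0 <= a -> a <= p -> m * (p - a) <= gap E Pf p - gap E Pf a.
Proof.
move=> a0 ap; have f0 := cone_ge0 Kf (lexx 0).
suff : gap E Pf a - m * a <= gap E Pf p - m * p by lra.
apply: (@nondecreasing_of_quadratic_defect R (fun s => gap E Pf s - m * s) a p (f 0)) => //.
move=> s t as_ st tp; have s0 := le_trans a0 as_.
have H1 := gap_increment_ge pE pPf st.
have H2 := cone_weighted_lipschitz Kf s0 st; have H3 := E_ge s0.
have ts : 0 <= t - s by lra.
have : (t - s) * (m - f 0 * (t - s)) <= (t - s) * (E (below s) - Pf (below t)).
  by rewrite ler_wpM2l//; lra.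
lra.
Qed.

Lemma gap_upper a p : 0 <= a -> a <= p -> gap E Pf p - gap E Pf a <= M * (p - a).
Proof.
move=> a0 ap; have f0 := cone_ge0 Kf (lexx 0).
suff : M * a - gap E Pf a <= M * p - gap E Pf p by lra.
apply: (@nondecreasing_of_quadratic_defect R (fun s => M * s - gap E Pf s) a p (f 0)) => //.
move=> s t as_ st tp; have s0 := le_trans a0 as_; have t0 := le_trans s0 st.
have H1 := gap_increment_le pE pPf st.
have H2 := cone_weighted_lipschitz Kf s0 st; have H3 := E_le t0.
have ts : 0 <= t - s by lra.
have : (t - s) * (E (below t) - Pf (below s)) <= (t - s) * (M + f 0 * (t - s)).
  by rewrite ler_wpM2l//; lra.
lra.
Qed.

(** The difference of the primitives of [h] and [f], that is, the fitted minus the true distribution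
    function. *)
Definition excess_mass s := Ph (below s) - Pf (below s).

Lemma excess_mass_lipschitz s t : 0 <= s -> s <= t ->
  `|excess_mass t - excess_mass s| <= (h 0 + f 0) * (t - s).
Proof.
move=> s0 st; have H1 := cone_weighted_lipschitz Kh s0 st.
have H2 := cone_weighted_lipschitz Kf s0 st.
have H3 := functional_below_le pPh st; have H4 := functional_below_le pPf st.
have ts : 0 <= t - s by lra.
have := mulr_ge0 (cone_ge0 Kf (lexx 0)) ts; have := mulr_ge0 (cone_ge0 Kh (lexx 0)) ts.
by rewrite ler_norml /excess_mass => *; apply/andP; split; lra.
Qed.

Lemma weighted_sub g : summable_fun g ->
  Ph g - Pf g = half_int (fun x => (h x - f x) * g x).
Proof.
move=> sg; rewrite /weighted -half_intB.
- by apply: eq_half_int => x _; rewrite mulrBl.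
- exact: (summable_funM (cone_measurable Kh) (cone_norm_le Kh)).
- exact: (summable_funM (cone_measurable Kf) (cone_norm_le Kf)).
Qed.

Lemma summable_sub_mul g : summable_fun g ->
  summable_fun (fun x => (h x - f x) * g x).
Proof.
move=> sg; apply: (@summable_eq _ (fun x => h x * g x - f x * g x)).
  by move=> x _; rewrite mulrBl.
apply: summable_funB.
  exact: (summable_funM (cone_measurable Kh) (cone_norm_le Kh)).
exact: (summable_funM (cone_measurable Kf) (cone_norm_le Kf)).
Qed.

Lemma excess_mass_decreasing s t : 0 <= s -> s <= t ->
  (forall x, s <= x -> x <= t -> h x - f x < 0) -> excess_mass t <= excess_mass s.
Proof.
move=> s0 st neg; rewrite -subr_le0 /excess_mass.
have sb := summable_funB (summable_below t) (summable_below s).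
have := weighted_sub sb.
rewrite (functionalB pPh (summable_below t) (summable_below s)).
rewrite (functionalB pPf (summable_below t) (summable_below s)) => H1.
suff : half_int (fun x => (h x - f x) * (below t x - below s x)) <= half_int (fun x => 0 * below s x).
  by rewrite half_intZ ?mul0r; [lra|exact: summable_below].
apply: le_half_int.
- exact: summable_sub_mul.
- exact/summable_funZ/summable_below.
move=> x x0; rewrite mul0r; have [xs|sx] := leP x s.
  by rewrite !below1 ?(le_trans xs st)// subrr mulr0.
rewrite (below0 sx) subr0; have [xt|tx] := leP x t; last by rewrite below0// mulr0.
by rewrite below1// mulr1 ltW// neg// ltW.
Qed.

Section AffinePiece.
Variables (a b : R).
Hypotheses (a0 : 0 <= a) (ab : a < b).
Hypothesis h_affine : forall u v, a < u -> u < b -> a < v -> v < b ->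
  h v = h u + rslope h u * (v - u).

(** [h] is affine and [f] convex; the case [z = b] rests on [cone_affine_closure]. *)
Lemma sub_concave x y z : a < x -> x < y -> y < z -> z <= b ->
  (z - y) * (h x - f x) + (y - x) * (h z - f z) <= (z - x) * (h y - f y).
Proof.
move=> ax xy yz zb; have x0 : 0 <= x by move: a0; lra.
have H1 := convex_three_points (proj1 Kf) x0 xy yz.
have -> : h y = h x + rslope h x * (y - x) by apply: h_affine; lra.
have -> : h z = h x + rslope h x * (z - x).
  have [->|zNb] := eqVneq z b.
    by apply: (cone_affine_closure Kh a0 h_affine); lra.
  by apply: h_affine => //; rewrite ?lt_neqAle ?zNb//; lra.
lra.
Qed.

(* [h - f] is compared with the line through its values at [a + c / 3] and at
   [p], where [c = p - a]; the slope of that line drops out because the weight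
   [x - (a + c / 3)] is orthogonal to [p - x] on [a, p]. *)
Lemma left_moment_ge0 p : a < p -> p < b -> 0 <= h p - f p ->
  gap Ph Pf p - gap Ph Pf a - (p - a) * excess_mass a <=
  2 / 3 * (p - a) * (excess_mass p - excess_mass a).
Proof.
move=> ap pb dp0; set c := p - a; have c0 : 0 < c by rewrite subr_gt0.
pose q := a + c / 3; pose dq := h q - f q; pose dp := h p - f p.
pose k := (dq - dp) / (2 * c / 3).
have aq : a < q by rewrite /q; lra.
have qp : q < p by rewrite /q /c; lra.
have kE : k * (2 * c / 3) = dq - dp by rewrite /k divfK// gt_eqF//; lra.
have sq := @summable_quad_on R a p (2 * c / 3) (- 1) 0 a0 (ltW ap).
have := weighted_sub sq.
rewrite !quad_on_functional ?(ltW ap)// => H1.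
suff : 0 <= half_int (fun x => (h x - f x) * quad_on a p (2 * c / 3) (- 1) 0 x).
  by rewrite -H1 /gap /excess_mass -/c; lra.
have : half_int (quad_on a p (2 * c / 3 * dp) (2 * c / 3 * k - dp) (- k)) <=
    half_int (fun x => (h x - f x) * quad_on a p (2 * c / 3) (- 1) 0 x).
  apply: le_half_int; first exact: summable_quad_on (ltW ap).
    exact: summable_sub_mul.
  move=> x x0; have [xa|ax] := leP x a.
    by rewrite !(quad_on_out _ _ _ (ltW ap))//; [rewrite mulr0|left|left].
  have [xp|px] := leP x p; last first.
    by rewrite !(quad_on_out _ _ _ (ltW ap))//; [rewrite mulr0|right|right].
  rewrite !quad_on_in//.
  (* A concave function is above its chord between [q] and [p] and below the extended chord left of
     [q], so both factors change sign together at [q]. *)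
  suff : 0 <= (x - q) * (h x - f x - (dp + k * (p - x))).
    by move=> HH; rewrite -subr_ge0; apply: le_trans HH _; rewrite le_eqVlt;
      apply/orP; left; apply/eqP; rewrite /q /c; field.
  have pq3 : p - q = 2 * c / 3 by rewrite /q /c; field.
  have [xq|qx|->] := ltgtP x q; last by rewrite subrr mul0r.
    rewrite mulr_le0// ?subr_le0 ?(ltW xq)//.
    have := sub_concave ax xq qp (ltW pb).
    rewrite -(ler_pM2l (_ : 0 < p - q)) ?subr_gt0//.
    rewrite -/dq -/dp => H2.
    suff -> : (p - q) * (dp + k * (p - x)) = (p - x) * dq - (q - x) * dp by lra.
    by rewrite mulrDr mulrA [_ * k]mulrC pq3 kE -pq3; ring.
  apply: mulr_ge0; first by rewrite subr_ge0 ltW.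
  have [->|xNp] := eqVneq x p; first by rewrite subrr mulr0 addr0 subrr.
  have xlp : x < p by rewrite lt_neqAle xNp.
  have := sub_concave aq qx xlp (ltW pb).
  rewrite subr_ge0 -(ler_pM2l (_ : 0 < p - q)) ?subr_gt0//.
  rewrite -/dq -/dp => H2.
  suff -> : (p - q) * (dp + k * (p - x)) = (p - x) * dq - (q - x) * dp by lra.
  by rewrite mulrDr mulrA [_ * k]mulrC pq3 kE -pq3; ring.
(* The slope [k] integrates out, which leaves [dp * c ^+ 2 / 6]. *)
apply: le_trans; rewrite half_int_quad_on ?(ltW ap)// -/c.
have : 0 <= dp * c ^+ 2 / 6 by rewrite divr_ge0// mulr_ge0// sqr_ge0.
lra.
Qed.

(** Mirror argument on [[p, b]]: the line passes through the values at [p] and at [q = b - c / 3]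
    with [c = b - p], and the weight [q - x] is orthogonal to [x - p]. *)
Lemma right_moment_ge0 p : a < p -> p < b -> 0 <= h p - f p ->
  1 / 3 * (b - p) * (excess_mass b - excess_mass p) <=
  gap Ph Pf b - gap Ph Pf p - (b - p) * excess_mass p.
Proof.
move=> ap pb dp0; set c := b - p; have c0 : 0 < c by rewrite subr_gt0.
have p0 : 0 <= p by move: a0; lra.
pose q := b - c / 3; pose dq := h q - f q; pose dp := h p - f p.
pose k := (dq - dp) / (2 * c / 3).
have pq : p < q by rewrite /q /c; lra.
have qb : q < b by rewrite /q; lra.
have kE : k * (2 * c / 3) = dq - dp by rewrite /k divfK// gt_eqF//; lra.
have sq := @summable_quad_on R p b (- (c / 3)) 1 0 p0 (ltW pb).
have := weighted_sub sq.
rewrite !quad_on_functional ?(ltW pb)// => H1.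
suff : 0 <= half_int (fun x => (h x - f x) * quad_on p b (- (c / 3)) 1 0 x).
  by rewrite -H1 /gap /excess_mass -/c; lra.
have : half_int (quad_on p b (- (c / 3) * (dp + k * c))
      (dp + k * c + c / 3 * k) (- k)) <=
    half_int (fun x => (h x - f x) * quad_on p b (- (c / 3)) 1 0 x).
  apply: le_half_int; first exact: summable_quad_on (ltW pb).
    exact: summable_sub_mul.
  move=> x x0; have [xp|px] := leP x p.
    by rewrite !(quad_on_out _ _ _ (ltW pb))//; [rewrite mulr0|left|left].
  have [xb|bx] := leP x b; last first.
    by rewrite !(quad_on_out _ _ _ (ltW pb))//; [rewrite mulr0|right|right].
  rewrite !quad_on_in//.
  suff : 0 <= (q - x) * (h x - f x - (dp + k * (x - p))).
    by move=> HH; rewrite -subr_ge0; apply: le_trans HH _; rewrite le_eqVlt;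
      apply/orP; left; apply/eqP; rewrite /q /c; field.
  have pq3 : q - p = 2 * c / 3 by rewrite /q /c; field.
  have lineE : (q - p) * (dp + k * (x - p)) = (q - x) * dp + (x - p) * dq.
    by rewrite mulrDr mulrA [_ * k]mulrC pq3 kE -pq3; ring.
  have [xq|qx|->] := ltgtP x q; last by rewrite subrr mul0r.
    apply: mulr_ge0; first by rewrite subr_ge0 ltW.
    have := sub_concave ap px xq (ltW qb).
    rewrite subr_ge0 -(ler_pM2l (_ : 0 < q - p)) ?subr_gt0// lineE.
    by rewrite -/dq -/dp; lra.
  rewrite mulr_le0// ?subr_le0 ?(ltW qx)//.
  have := sub_concave ap pq qx xb.
  rewrite -(ler_pM2l (_ : 0 < q - p)) ?subr_gt0// lineE.
  by rewrite -/dq -/dp; lra.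
apply: le_trans; rewrite half_int_quad_on ?(ltW pb)// -/c.
have : 0 <= dp * c ^+ 2 / 6 by rewrite divr_ge0// mulr_ge0// sqr_ge0.
lra.
Qed.

Hypothesis mass_a : Ph (below a) = E (below a).
Hypothesis mass_b : Ph (below b) = E (below b).

Let b0 : 0 <= b. Proof. exact: le_trans a0 (ltW ab). Qed.

(** Write D for [excess_mass]. Where [h >= f], the moment bound and the gap comparison give
    [m <= 2/3 D(q) + 1/3 D(a)], and [D(a) <= M] because the masses agree at [a]; this yields the
    constants. Elsewhere D decreases, towards a value [D(b) >= m]. *)
Lemma excess_mass_ge p : (forall r, a < r -> r < b -> gap Ph E a <= gap Ph E r) ->
  a < p -> p < b -> 3 / 2 * m - 1 / 2 * M <= excess_mass p.
Proof.
move=> gap_a ap pb.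
have p0 : 0 <= p by move: a0; lra.
have ma := E_ge a0; have Ma := E_le a0; have mb := E_ge b0; have Mb := E_le b0.
apply: (@ge_of_descent _ excess_mass (fun x => h x - f x) p b (h 0 + f 0)) => //.
- by rewrite addr_ge0// cone_ge0.
- by move=> s t ps st _; apply: excess_mass_lipschitz => //; exact: le_trans ps.
- by move=> s t ps st _; apply: excess_mass_decreasing => //; exact: le_trans ps.
- by rewrite /excess_mass mass_b; lra.
move=> q pq qb dq0; have aq : a < q by exact: lt_le_trans pq.
have H1 := left_moment_ge0 aq qb dq0; have H2 := gap_a q aq qb.
have H3 := gap_lower a0 (ltW aq).
have : (q - a) * m <= (q - a) * (excess_mass a + 2 / 3 * (excess_mass q - excess_mass a)).
  by move: H1 H2 H3; rewrite /gap; lra.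
rewrite ler_pM2l ?subr_gt0// {1 3}/excess_mass mass_a; lra.
Qed.

(** Here the right endpoint serves: [2/3 D(q) + 1/3 D(b) <= M] where [h >= f], with [D(b) >= m]. *)
Lemma excess_mass_le p : (forall r, a < r -> r < b -> gap Ph E b <= gap Ph E r) ->
  a < p -> p < b -> excess_mass p <= 3 / 2 * M - 1 / 2 * m.
Proof.
move=> gap_b ap pb.
have ma := E_ge a0; have Ma := E_le a0; have mb := E_ge b0; have Mb := E_le b0.
apply: (@le_of_ascent _ excess_mass (fun x => h x - f x) a p (h 0 + f 0)) => //.
- by rewrite addr_ge0// cone_ge0.
- by move=> s t as_ st _; apply: excess_mass_lipschitz => //; exact: le_trans as_.
- by move=> s t as_ st _; apply: excess_mass_decreasing => //; exact: le_trans as_.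
- by rewrite /excess_mass mass_a; lra.
move=> q aq qp dq0; have qb : q < b by exact: le_lt_trans qp pb.
have q0 : 0 <= q by move: a0; lra.
have H1 := right_moment_ge0 aq qb dq0; have H2 := gap_b q aq qb.
have H3 := gap_upper q0 (ltW qb).
have : (b - q) * (excess_mass q + 1 / 3 * (excess_mass b - excess_mass q)) <= (b - q) * M.
  by move: H1 H2 H3; rewrite /gap; lra.
rewrite ler_pM2l ?subr_gt0// {2}/excess_mass mass_b; lra.
Qed.

End AffinePiece.

End Comparison.

(** * Intervals between consecutive zeros of the gap *)

Section Components.
Context {R : realType}.
Variables (h : R -> R) (A B : (R -> R) -> R) (C : R).
Hypothesis Kh : convex_cone h.
Hypotheses (pA : positive_functional A) (pB : positive_functional B).
Hypothesis C0 : 0 <= C.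
Hypothesis B_le : forall s, B (below s) <= C.
Hypothesis statAB : stationary A B h.
Implicit Types (a b p s u v : R).

(** A last zero before [p] exists since the gap vanishes at 0. If no zero follows [p], then [h] is
    affine on a whole half-line, and integrability forces it to vanish there. *)
Lemma gap_component p : 0 < p -> gap A B p <> 0 ->
  exists a, [/\ 0 <= a, a < p, gap A B a = 0 &
    (exists b, [/\ p < b, gap A B b = 0 &
       forall u v, a < u -> u < b -> a < v -> v < b ->
         h v = h u + rslope h u * (v - u)])
    \/ forall u, a < u -> h u = 0].
Proof.
move=> p0 gp.
have L0 q : 0 <= A (below q) + C by rewrite addr_ge0// functional_below_ge0.
have lip q := gap_lipschitz pA pB C0 B_le (p := q).
have [a [a0 ap ga aN]] :=
  last_zero p0 (L0 p) (@lip p) (gap0 pA pB) gp.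
exists a; split=> //.
have [[q [pq gq]]|noz] := pselect (exists q, p < q /\ gap A B q = 0).
  left; have [b [pb gb bN]] := first_zero (ltW p0) pq (L0 q) (@lip q) gq gp.
  exists b; split=> // u v au ub av vb.
  apply: (cone_affine Kh pA pB C0 B_le statAB a0 _ au ub av vb).
  move=> s as_ sb; have [sp|ps] := leP s p; first exact: aN.
  exact: (bN _ (ltW ps) sb).
right; apply: (cone_affine_tail Kh a0) => u v au av.
apply: (cone_affine Kh pA pB C0 B_le statAB a0 (b := Num.max u v + 1)) => //.
- move=> s as_ _; have [sp|ps] := leP s p; first exact: aN.
  by move=> gs; apply: noz; exists s.
- by rewrite ltr_pwDr// le_max lexx.
- by rewrite ltr_pwDr// le_max lexx orbT.
Qed.

End Components.

(** * Bounds for a fixed sample of positive observations *)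

Section Deterministic.
Context {R : realType} {n : nat}.
Variables (x : 'I_n -> R) (h f : R -> R) (m M : R).
Hypothesis n_gt0 : (0 < n)%N.
Hypothesis x_gt0 : forall i, 0 < x i.
Hypotheses (Kh : convex_cone h) (Kf : convex_cone f).
Implicit Types (a b p s u : R) (c : 'I_n -> R).

Notation E := (sampled (fun=> n%:R^-1) x).

Hypothesis E_ge : forall s, 0 <= s -> m <= E (below s) - weighted f (below s).
Hypothesis E_le : forall s, 0 <= s -> E (below s) - weighted f (below s) <= M.

Let x_ge0 i : 0 <= x i. Proof. exact: ltW. Qed.

Let pE : positive_functional E.
Proof. by apply: sampled_positive => // i; rewrite invr_ge0. Qed.

Lemma sampled_below0 c : sampled c x (below 0) = 0.
Proof.
by rewrite /sampled big1// => i _; rewrite below0// mulr0.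
Qed.

Lemma sampled_below_le c s : (forall i, 0 <= c i) ->
  sampled c x (below s) <= \sum_(i < n) c i.
Proof.
move=> c0; apply: ler_sum => i _; rewrite -[leRHS]mulr1 ler_wpM2l//.
exact: below_le1.
Qed.

Lemma weighted_primitive (g : R -> R) s : weighted g (below s) = primitive g s.
Proof. by rewrite primitiveE; apply: eq_half_int => y _; rewrite mulrC. Qed.

Lemma weighted_below0 (g : R -> R) : weighted g (below 0) = 0.
Proof. by rewrite weighted_primitive /primitive set_itv1 Rintegral_set1. Qed.

Lemma weighted_below_tail a p : a <= p -> (forall u, a < u -> h u = 0) ->
  weighted h (below p) = weighted h (below a).
Proof.
move=> ap hz; apply: eq_half_int => y y0; have [ya|ay] := leP y a.
  by rewrite !below1// (le_trans ya).
by rewrite hz// !mul0r.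
Qed.

Let mM : m <= M.
Proof. exact: le_trans (E_ge (lexx 0)) (E_le (lexx 0)). Qed.

Lemma ml_lower_bound p : is_ml_estimator x h -> 0 <= p ->
  3 / 2 * m - 1 / 2 * M <= excess_mass h f p.
Proof.
move=> est p0; have h_gt0 := ml_positive n_gt0 x_ge0 est.
have stat := ml_stationary n_gt0 x_ge0 est.
have pA := @lebesgue_positive R; have pB := likelihood_positive x_gt0 h_gt0.
have A_lip (s t : R) : 0 <= s -> s <= t -> weighted (fun=> 1) (below t)
    - weighted (fun=> 1) (below s) <= 1 * (t - s).
  by apply: weighted_below_lipschitz => // y _; rewrite ler01 lexx.
have c0 i : 0 <= (n%:R * h (x i))^-1 by rewrite invr_ge0 mulr_ge0// ltW.
have B_le s := sampled_below_le s c0.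
have C0 : 0 <= \sum_(i < n) (n%:R * h (x i))^-1 by exact: sumr_ge0.
have mass1 a : 0 <= a -> gap (weighted (fun=> 1))
    (sampled (fun i => (n%:R * h (x i))^-1) x) a = 0 ->
    weighted (fun=> 1) (below a) =
    sampled (fun i => (n%:R * h (x i))^-1) x (below a).
  rewrite le_eqVlt => /predU1P[<- _|a0 ga]; last first.
    exact: (gap0_mass_eq Kh pA pB ler01 A_lip stat a0 ga).
  by rewrite sampled_below0 weighted_below0.
have mass2 a : 0 <= a -> gap (weighted (fun=> 1))
    (sampled (fun i => (n%:R * h (x i))^-1) x) a = 0 ->
    weighted h (below a) = E (below a).
  move=> a0 ga; have := mass1 a a0 ga.
  move: a0 ga; rewrite le_eqVlt => /predU1P[<- _ _|a0 ga m1]; last first.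
    exact: ml_mass_eq.
  by rewrite sampled_below0 weighted_below0.
(* Where the fitted mass is at least the empirical one, [m] itself is a lower bound, and
   [m <= M]. *)
have of_mass_ge : E (below p) <= weighted h (below p) ->
    3 / 2 * m - 1 / 2 * M <= excess_mass h f p.
  by have := E_ge p0; rewrite /excess_mass; move: mM; lra.
move: (p0); rewrite le_eqVlt => /predU1P[p00|pp].
  by apply: of_mass_ge; rewrite -p00 sampled_below0 weighted_below0.
have [gp|gp] := eqVneq (gap (weighted (fun=> 1))
    (sampled (fun i => (n%:R * h (x i))^-1) x) p) 0.
  by apply: of_mass_ge; rewrite mass2.
have [a [a0 ap ga [[b [pb gb aff]]|hz]]] :=
  gap_component Kh pA pB C0 B_le stat pp (elimN eqP gp).
  have ab := lt_trans ap pb; have b0 := le_trans a0 (ltW ab).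
  apply: (excess_mass_ge Kh Kf pE E_ge E_le a0 ab aff (mass2 a a0 ga) (mass2 b b0 gb)) => //.
  move=> r ar rb.
  exact: (ml_gap_le x_gt0 Kh h_gt0 stat a0 ga (mass1 a a0 ga) (mass2 a a0 ga) aff ar rb).
(* [h] vanishes beyond [a] but is positive at each observation, so the whole sample lies in
   [[0, a]]. *)
apply: of_mass_ge; rewrite (weighted_below_tail (ltW ap) hz) (mass2 a a0 ga).
apply: ler_sum => i _; rewrite ler_wpM2l ?invr_ge0//.
rewrite [leRHS]below1 ?below_le1// leNgt; apply/negP => /hz hx0.
by have := h_gt0 i; rewrite hx0 ltxx.
Qed.

(** For least squares the gap itself compares the fitted and empirical measures and is minimal at
    both ends of the interval, which gives both bounds; the likelihood bound instead goes through
    [ml_gap_le] at the left end. *)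
Lemma ls_bounds p : is_ls_estimator x h -> 0 <= p ->
  3 / 2 * m - 1 / 2 * M <= excess_mass h f p <= 3 / 2 * M - 1 / 2 * m.
Proof.
move=> est p0; have stat := ls_stationary x_ge0 est.
have pA := cone_weighted_positive Kh.
have A_lip s t := @cone_weighted_lipschitz R h s t Kh.
have h00 := cone_ge0 Kh (lexx 0).
have nV0 : 0 <= n%:R^-1 :> R by rewrite invr_ge0.
have B_le s := sampled_below_le s (fun=> nV0).
have C0 : 0 <= \sum_(i < n) (n%:R^-1 : R) by exact: sumr_ge0.
have mass a : 0 <= a -> gap (weighted h) E a = 0 -> weighted h (below a) = E (below a).
  rewrite le_eqVlt => /predU1P[<- _|a0 ga]; last first.
    exact: (gap0_mass_eq Kh pA pE h00 A_lip stat a0 ga).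
  by rewrite sampled_below0 weighted_below0.
have of_mass : weighted h (below p) = E (below p) ->
    3 / 2 * m - 1 / 2 * M <= excess_mass h f p <= 3 / 2 * M - 1 / 2 * m.
  rewrite /excess_mass => ->; have := E_ge p0; have := E_le p0; move: mM => *.
  by apply/andP; split; lra.
move: (p0); rewrite le_eqVlt => /predU1P[p00|pp].
  by apply: of_mass; rewrite -p00 sampled_below0 weighted_below0.
have [gp|gp] := eqVneq (gap (weighted h) E p) 0.
  by apply: of_mass; rewrite mass.
have [a [a0 ap ga [[b [pb gb aff]]|hz]]] :=
  gap_component Kh pA pE C0 B_le stat pp (elimN eqP gp).
  have ab := lt_trans ap pb; have b0 := le_trans a0 (ltW ab).
  apply/andP; split.
    apply: (excess_mass_ge Kh Kf pE E_ge E_le a0 ab aff (mass a a0 ga) (mass b b0 gb)) => //.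
    by move=> r _ _; rewrite ga; exact: (gap_ge0 Kh pA pE stat r).
  apply: (excess_mass_le Kh Kf pE E_ge E_le a0 ab aff (mass a a0 ga) (mass b b0 gb)) => //.
  by move=> r _ _; rewrite gb; exact: (gap_ge0 Kh pA pE stat r).
apply: of_mass; apply/eqP; rewrite eq_le; apply/andP; split.
  rewrite (weighted_below_tail (ltW ap) hz) (mass a a0 ga).
  exact: (functional_below_le pE (ltW ap)).
(* If [E] had more mass than [h] below [p], the gap would decrease at a
   positive rate on [p, +oo[. *)
rewrite leNgt; apply/negP => lt_mass.
set k := E (below p) - weighted h (below p).
have k0 : 0 < k by rewrite subr_gt0.
pose r := p + (gap (weighted h) E p + 1) / k.
have gp0 := gap_ge0 Kh pA pE stat p.
have pr : p <= r by rewrite lerDl; apply: divr_ge0; [exact: addr_ge0|exact: ltW].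
have := gap_increment_le pA pE pr; have := gap_ge0 Kh pA pE stat r.
rewrite (weighted_below_tail (le_trans (ltW ap) pr) hz).
rewrite -(weighted_below_tail (ltW ap) hz).
have -> : weighted h (below p) - E (below p) = - k by rewrite opprB.
have -> : (r - p) * - k = - (gap (weighted h) E p + 1).
  by rewrite /r mulrN addrAC subrr add0r divfK// gt_eqF.
by lra.
Qed.

End Deterministic.

(** * From the fixed-sample bounds to the almost sure inequalities *)

Theorem theorem1 (d : measure_display) (T : measurableType d) (R : realType)
    (P : probability T R) (n : nat) (X : 'I_n -> {RV P >-> R})
    (f F : R -> R)
    (n_ge1 : (1 <= n)%N)
    (X_indep : mutually_independent X)
    (X_cdf : forall (i : 'I_n) (r : R), cdf (X i) r = (F r)%:E)
    (f_density : convex_density f)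
    (F_f : forall r : R, F r = primitive f r) :
  {ae P, forall w : T,
    let x := fun i : 'I_n => X i w in
    (forall f_ml : R -> R, is_ml_estimator x f_ml ->
       inf_halfline (primitive f_ml \- F) >=
         3 / 2 * inf_halfline (edf x \- F)
         - 1 / 2 * sup_halfline (edf x \- F)) /\
    (forall f_ls : R -> R, is_ls_estimator x f_ls ->
       sup_norm (primitive f_ls \- F) <= 2 * sup_norm (edf x \- F))}.
Proof.
have Kf : convex_cone f by case: f_density.
(* [F 0] is an integral over a single point, so each observation is positive almost surely. *)
have X_gt0 : {ae P, forall w, forall i, 0 < X i w}.
  apply: filter_forall => i.
  exists (X i @^-1` `]-oo, 0]%classic); split.
  - by rewrite -[X in measurable X]setTI; exact: measurable_funPT.
  - have := X_cdf i 0; rewrite F_f /primitive set_itv1 Rintegral_set1.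
    by rewrite /cdf.
  - by move=> w /= /negP; rewrite -leNgt in_itv.
apply: filterS X_gt0 => w Xw; set x := fun i : 'I_n => X i w.
have n0 : (0 < n)%N := n_ge1.
have x_gt0 i : 0 < x i := Xw i.
(* Bounds on [edf] and [F] make the real-valued infimum and suprema of their difference genuine. *)
have edf01 s : 0 <= edf x s <= 1.
  rewrite -sampled_edf; apply/andP; split.
    by apply: sumr_ge0 => i _; rewrite mulr_ge0 ?invr_ge0// below_ge0.
  apply: (le_trans (sampled_below_le x s _)).
    by move=> i; rewrite invr_ge0.
  by rewrite sumr_const card_ord -[leLHS]mulr_natr mulVf// pnatr_eq0 -lt0n.
have F01 s : 0 <= F s <= 1.
  by have := cdf_ge0 (X (Ordinal n0)) s; have := cdf_le1 (X (Ordinal n0)) s;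
    rewrite X_cdf !lee_fin => -> ->.
have GE s : edf x s - F s =
    sampled (fun=> n%:R^-1) x (below s) - weighted f (below s).
  by rewrite sampled_edf weighted_primitive F_f.
have DE (h : R -> R) s : (primitive h \- F) s = excess_mass h f s.
  by rewrite /= F_f /excess_mass !weighted_primitive.
have H0 : (`[0, +oo[%classic : set R) 0 by rewrite /= in_itv/= lexx.
split=> [h est|h est]; have Kh := proj1 est.
  rewrite /inf_halfline; apply: lb_le_inf; first by eexists; exists 0.
  move=> _ [p /halflineP p0 <-]; rewrite DE.
  apply: (ml_lower_bound n0 x_gt0 Kh Kf _ _ est p0) => s s0; rewrite -GE.
    apply: ge_inf; last by exists s => //; apply/halflineP.
    by exists (- 1) => _ [t _ <-] /=; have := edf01 t; have := F01 t; lra.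
  apply: ub_le_sup; last by exists s => //; apply/halflineP.
  by exists 1 => _ [t _ <-] /=; have := edf01 t; have := F01 t; lra.
set N := sup_norm (edf x \- F).
have GN s : 0 <= s -> `|edf x s - F s| <= N.
  move=> s0; apply: ub_le_sup; last by exists s => //; apply/halflineP.
  exists 1 => _ [t _ <-] /=; rewrite ler_norml.
  by have := edf01 t; have := F01 t; lra.
rewrite /sup_norm /sup_halfline; apply: ge_sup; first by eexists; exists 0.
move=> _ [p /halflineP p0 <-]; rewrite DE.
(* With [m = - N] and [M = N] the two bounds become [- 2 * N] and [2 * N]. *)
have := @ls_bounds R n x h f (- N) N x_gt0 Kh Kf.
have lo s : 0 <= s -> - N <=
    sampled (fun=> n%:R^-1) x (below s) - weighted f (below s).
  by move=> /GN; rewrite -GE ler_norml => /andP[].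
have up s : 0 <= s ->
    sampled (fun=> n%:R^-1) x (below s) - weighted f (below s) <= N.
  by move=> /GN; rewrite -GE ler_norml => /andP[].
move=> /(_ lo up p est p0) /andP[lb ub].
by rewrite ler_norml; apply/andP; split; lra.
Qed.
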